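(* Let $\ell\ge 1$ and $0\le m\le \ell$ be integers, let $\Lambda_\ell=(3\ell-2,3\ell-5,\dots,7,4,1)$, and let $\mathcal F_1^m(\Lambda_\ell)$ be the set of strict partitions obtained from $\Lambda_\ell$ by adding $m$ nodes labelled $1$ (defined in the context). Then $$\sum_{\mu\in\mathcal F_1^m(\Lambda_\ell)}\bar\delta_3(\mu)\,S_{\mu^b[1]}(\boldsymbol x)=\varepsilon(\ell,m)\,\big(p_2\circ S_{\square(\ell-m,m)}\big)(\boldsymbol x),$$ where $$\varepsilon(\ell,m)=\begin{cases}(-1)^{\binom m2}, & 0\le m\le \ell/2,\\ (-1)^{\binom{\ell-m+1}{2}+(\ell-m)m}, & \ell/2\le m\le \ell.\end{cases}$$
   Context: $S_\lambda(\boldsymbol x)$ denotes the Schur function in variables $\boldsymbol x=(x_1,x_2,\dots)$; $\square(n,m)$ denotes the rectangular partition $(m^n)=(m,\dots,m)$ ($n$ parts). For a symmetric function $F$, the plethysm is $(p_2\circ F)(\boldsymbol x)=F(x_1^2,x_2^2,\dots)$. Nodes of $\Lambda_\ell$: in each row of a Young diagram of a strict partition, fill the cells from the left with the repeating pattern $0,1,0,0,1,0,\dots$ (i.e. the cell in column $j$ gets label $1$ iff $j\equiv 2 \pmod 3$). Row $i$ ($1\le i\le \ell$) of $\Lambda_\ell$ has length $3(\ell-i)+1$, and the cell that can be added at the end of row $i$ has label $1$. Thus $\mathcal F_1^m(\Lambda_\ell)$ is the set of the $\binom{\ell}{m}$ partitions $\Lambda_\ell+\sum_{i\in I}e_i$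 with $I\subseteq\{1,\dots,\ell\}$, $|I|=m$ ($e_i$ the $i$-th unit vector), i.e. adding one box at the end of each row $i\in I$. $r$-quotient: for a partition $\lambda=(\lambda_1,\dots,\lambda_N)$ padded with zeros so that $N$ is a multiple of $r$, put $\delta_N=(N-1,\dots,1,0)$, $\xi=\lambda+\delta_N$, and for $k=0,\dots,r-1$ let $\xi^{(k)}=(\xi^{(k)}_1>\dots>\xi^{(k)}_{N_k})$ be the elements of $\{(\xi_i-k)/r:\xi_i\equiv k \pmod r\}$ in decreasing order; then $\lambda[k]=\xi^{(k)}-\delta_{N_k}$, and $(\lambda[0],\dots,\lambda[r-1])$ is the $r$-quotient. Double: for a strict partition $\lambda=(\lambda_1>\dots>\lambda_l>0)$, $D(\lambda)$ is the partition with Frobenius notation $(\lambda_1,\dots,\lambda_l\mid \lambda_1-1,\dots,\lambda_l-1)$. The 3-bar quotient component $\lambda^b[1]$ is defined as $D(\lambda)[1]$, the component with index $1$ of the $3$-quotient of $D(\lambda)$. 3-bar sign $\bar\delta_3(\lambda)$ of a strict partition $\lambda$ with $l$ parts: place beads at the positions $\lambda_1,\dots,\lambda_l$ among the nonnegative integers, arranged in three runners (runner $k$ = positions $\equiv k\pmod 3$). Natural numbering: number the beads $1,\dots,l$ in increasing order of position. 3-bar numbering: first number the beads of runner $0$ in increasing order; next, pairing the $j$-th smallest bead of runner $1$ with the $j$-th smallest bead of runner $2$ ($j=1,\dots,$ the smaller of the two bead counts), go through the pairs for increasing $j$, numbering within each pair the runner-$2$ bead before the runner-$1$ bead; finally number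 the remaining beads in increasing order of position. Let $\bar\sigma_3(\lambda)$ be the permutation sending the natural number of each bead to its 3-bar number; $\bar\delta_3(\lambda)=\operatorname{sgn}\bar\sigma_3(\lambda)$. *)

(* Defs.v *)
From HB Require Import structures.
From mathcomp Require Import all_boot all_order all_algebra all_fingroup.
From mathcomp Require Export ssrint.
From mathcomp Require Import zify.
From mathcomp Require Export mpoly.

Set Implicit Arguments.
Unset Strict Implicit.
Unset Printing Implicit Defensive.

Import GRing.Theory.
Local Open Scope ring_scope.

(* Partitions are sequences of parts lam_1 >= lam_2 >= ..., taken up to
   trailing zeros; rows, columns and variables are indexed from 0. *)

(* A symmetric function F(x_1, x_2, ...) over the integers is given, as an
   element of the inverse limit of the rings of symmetric polynomials, by its
   restrictions F(x_1, ..., x_n, 0, 0, ...) for all n. *)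
Definition symfun := forall n : nat, {mpoly int[n]}.

Definition cell (lam : seq nat) : finType :=
  {i : 'I_(size lam) & 'I_(nth 0%N lam i)}.

Definition semistandard (lam : seq nat) (n : nat)
    (T : {ffun cell lam -> 'I_n}) : bool :=
  [forall c : cell lam, forall d : cell lam,
     ((tag c == tag d) && (tagged c < tagged d)%N ==> (T c <= T d)%N) &&
     ((tag c < tag d)%N && (tagged c == tagged d :> nat) ==> (T c < T d)%N)].

Definition schur (lam : seq nat) : symfun := fun n =>
  \sum_(T : {ffun cell lam -> 'I_n} | semistandard T)
     \prod_(c : cell lam) 'X_(T c).

Definition plethysm_p2 (F : symfun) : symfun := fun n =>
  comp_mpoly [tuple ('X_i : {mpoly int[n]}) ^+ 2 | i < n] (F n).

Definition rectangle (n m : nat) : seq nat := nseq n m.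

Definition strict_partition (lam : seq nat) : bool :=
  sorted gtn lam && (0%N \notin lam).

(* j is the usual, 1-based, column number. *)
Definition column_label (j : nat) : nat := (if j %% 3 == 2 then 1 else 0)%N.

(* All strict partitions obtained by adding one cell of label 1; the value
   i = size lam creates a new row. *)
Definition add_node1 (lam : seq nat) : seq (seq nat) :=
  [seq mu <- [seq incr_nth lam i | i <- iota 0 (size lam).+1
                 & column_label (nth 0%N lam i).+1 == 1%N]
     | strict_partition mu].

(* The set F_1^m(lam), as a duplicate-free sequence. *)
Fixpoint add_nodes1 (m : nat) (lam : seq nat) : seq (seq nat) :=
  if m is m'.+1 then
    undup (flatten [seq add_node1 mu | mu <- add_nodes1 m' lam])
  else [:: lam].

Definition Lambda (l : nat) : seq nat := mkseq (fun i => 3 * (l - i.+1) + 1)%N l.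

(* lam is padded to N = r * size lam parts; another admissible N only changes
   the number of trailing zeros of the result. *)
Definition beta_numbers (r : nat) (lam : seq nat) : seq nat :=
  let N := (r * size lam)%N in mkseq (fun i => nth 0 lam i + (N - i.+1))%N N.

(* The component lam[k] of the r-quotient.  The beta numbers of a partition
   are strictly decreasing, so that xi is already in decreasing order. *)
Definition quotient_component (r : nat) (lam : seq nat) (k : nat) : seq nat :=
  let xi := [seq ((x - k) %/ r)%N | x <- beta_numbers r lam & (x %% r == k)%N] in
  mkseq (fun i => nth 0 xi i - (size xi - i.+1))%N (size xi).

(* The partition (a_1, ..., a_d | b_1, ..., b_d) in Frobenius notation: its
   first d rows are a_i + i, its first d columns are b_i + i, and its
   remaining rows are contained in these columns. *)
Definition frobenius (a b : seq nat) : seq nat :=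
  mkseq (fun j => if (j < size a)%N then (nth 0 a j + j.+1)%N
                  else count (fun i => j < nth 0 b i + i.+1)%N (iota 0 (size b)))
        (if b is b1 :: _ then b1.+1 else 0%N).

Definition double_partition (lam : seq nat) : seq nat :=
  frobenius lam [seq x.-1 | x <- lam].

Definition bar_quotient1 (lam : seq nat) : seq nat :=
  quotient_component 3 (double_partition lam) 1.

Definition natural_order (lam : seq nat) : seq nat := sort leq lam.

Definition runner (lam : seq nat) (k : nat) : seq nat :=
  [seq x <- natural_order lam | (x %% 3 == k)%N].

Definition bar_order (lam : seq nat) : seq nat :=
  let r1 := runner lam 1 in
  let r2 := runner lam 2 in
  let p := minn (size r1) (size r2) in
  runner lam 0 ++ flatten [seq [:: q.2; q.1] | q <- zip r1 r2]
    ++ sort leq (drop p r1 ++ drop p r2).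

(* The bead with natural number i is sent to its 3-bar number, both counted
   from 0.  By bar_permE the default values of insubd are irrelevant. *)
Definition bar_perm (lam : seq nat) : 'S_(size lam) :=
  insubd (1%g : 'S_(size lam))
    [ffun i : 'I_(size lam) =>
       insubd i (index (nth 0%N (natural_order lam) i) (bar_order lam))].

Definition bar_sign (lam : seq nat) : int := (-1) ^+ odd_perm (bar_perm lam).

(* The two cases overlap at m = l / 2, where they agree. *)
Definition epsilon (l m : nat) : int :=
  if (m.*2 <= l)%N then (-1) ^+ 'C(m, 2)
  else (-1) ^+ ('C((l - m).+1, 2) + (l - m) * m).

Local Lemma perm_zip_drop (s t : seq nat) : let p := minn (size s) (size t) in
  perm_eq (flatten [seq [:: q.2; q.1] | q <- zip s t] ++ (drop p s ++ drop p t))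
          (s ++ t).
Proof.
elim: s t => [|x s IHs] [|y t] /=; rewrite ?min0n ?minn0 ?drop0 ?cats0 //.
rewrite minnSS; apply/seq.permP=> a; have /seq.permP/(_ a) := IHs t.
by rewrite /= !count_cat /= => E; lia.
Qed.

Lemma perm_bar_order (lam : seq nat) : perm_eq (bar_order lam) lam.
Proof.
suff: perm_eq (bar_order lam) (natural_order lam).
  by move/perm_trans; apply; rewrite perm_sort.
apply/seq.permP=> a; rewrite /bar_order !count_cat.
have /seq.permP/(_ a) := perm_zip_drop (runner lam 1) (runner lam 2).
rewrite !count_cat => E.
have /permPl/seq.permP/(_ a) := perm_sort leq
  (drop (minn (size (runner lam 1)) (size (runner lam 2))) (runner lam 1) ++
   drop (minn (size (runner lam 1)) (size (runner lam 2))) (runner lam 2)).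
rewrite !count_cat => ->; rewrite {}E.
rewrite /runner !count_filter; elim: (natural_order lam) => //= x s <-.
by have := ltn_pmod x (isT : 0 < 3)%N; case: (x %% 3)%N => [|[|[|]]] //= _; case: (a x); lia.
Qed.

Lemma bar_permE (lam : seq nat) (i : 'I_(size lam)) : uniq lam ->
  bar_perm lam i = index (nth 0%N (natural_order lam) i) (bar_order lam) :> nat.
Proof.
move=> Ul; have pN : perm_eq (natural_order lam) lam by rewrite perm_sort.
have UN : uniq (natural_order lam) by rewrite (perm_uniq pN).
have sN := perm_size pN; have pB := perm_bar_order lam.
have memB j : (j < size lam)%N -> nth 0%N (natural_order lam) j \in bar_order lam.
  by move=> lt_j; rewrite (perm_mem pB) -(perm_mem pN) mem_nth ?sN.
have ltB (j : 'I_(size lam)) :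
    (index (nth 0%N (natural_order lam) j) (bar_order lam) < size lam)%N.
  by rewrite -[X in (_ < X)%N](perm_size pB) index_mem memB.
rewrite /bar_perm; set f := finfun _.
have fE j : f j = index (nth 0%N (natural_order lam) j) (bar_order lam) :> nat.
  by rewrite ffunE val_insubd ltB.
have inj_f : injectiveb f.
  apply/injectiveP=> j k /(congr1 val); rewrite /= !fE => /index_inj.
  move=> /(_ 0%N (memB _ (ltn_ord _)) (memB _ (ltn_ord _))) /eqP.
  by rewrite nth_uniq ?sN // => /eqP/val_inj.
have <- : f i = insubd (1%g : 'S_(size lam)) f i; last exact: fE.
by rewrite -pvalE val_insubd inj_f.
Qed.

(* Main.v *)
Require Import Defs.
From mathcomp Require Import all_boot all_order all_algebra.
From mathcomp Require Import all_fingroup zify ring.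
Local Open Scope ring_scope.

(** Take k = l - m, write mu through the set U of indices u of the k parts
    3u + 1 that did not grow, and let I be the complement of U.  The component
    mu^b[1] has the 2k beta numbers {l + u, l - 1 - u : u in U}, and bar_sign mu
    is epsilon l m times the sign of the word I U.  With the Jacobi-Trudi
    formula the left side becomes, up to sign,
      sum_U +- det (rows v_(l + u), v_(l - 1 - u), u in U),
    where v_c is the row (h_(c - q))_q: that is, the divided power
    omega^k / k! of omega = sum_u +- v_(l + u) /\ v_(l - 1 - u).  The
    coefficient of omega in row positions p, q is
    +- sum_c (-1)^c h_(c - p) h_(2l - 1 - c - q), which vanishes unless p + q is
    odd and is otherwise +- h_((2l - 1 - p - q) / 2) evaluated at the squares
    x_i^2, since H(t) H(-t) is the generating function of these.  So omega^k / k!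
    is a k x k determinant, the Jacobi-Trudi determinant of the rectangle at the
    squares. *)

Set Implicit Arguments.
Unset Strict Implicit.
Unset Printing Implicit Defensive.
Import Order.TTheory GRing.Theory Num.Theory.

(** * Sums of determinants over pairs of rows *)

(** No exterior algebra is built: the top coefficient of [omega ^ k] is the permutation sum
    [pair_sum], the sum over subsets is first a sum over all functions, and k! is cancelled at the
    end, which is legitimate over the integers. The collapse to size k comes from parity: with the
    2k columns listed evens first, the skew matrix of omega has zero diagonal blocks, so its
    Pfaffian is, up to sign, the determinant of one off-diagonal block. The two beads per u come
    from the double: in its set of N beta numbers a part p of mu produces a bead at N + p and a gap
    at N - p. For N divisible by 3, a part 3u + 1 thus shows on runner 1 above N and a part 3u + 2
    on runner 1 below N. The factor [epsilon l m] is the cost of alternating runners 2 and 1 in the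
    3-bar numbering. The remaining sign, that of the word I U, is exactly what the row signs (-1)^u
    of omega and the reorderings of rows and columns produce. *)

Section PairDeterminants.
Variables (R : comNzRingType) (k : nat).

(** A polarized Pfaffian: for constant [B] it is, up to a sign depending only on k, k! Pf(B - B^T).
    Pairing the positions i and k + i fits the stacking of two blocks of rows in [pair_det]. *)
Definition pair_sum (B : 'I_k -> 'M[R]_(k + k)) : R :=
  \sum_(s : 'S_(k + k)) (-1) ^+ s *
    \prod_(i < k) B i (s (lshift k i)) (s (rshift k i)).

(** Exchanging the two positions of the pair p reverses the sign and keeps the product. Even
    permutations are matched with odd ones, since a conclusion from S = -S would need 2 to be
    regular in [R]. *)
Lemma pair_sum_sym (B : 'I_k -> 'M[R]_(k + k)) (p : 'I_k) :
  (B p)^T = B p -> pair_sum B = 0.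
Proof.
move=> symB; rewrite /pair_sum (bigID (@odd_perm _)) /=.
apply: canLR (subrK _) _; rewrite add0r -sumrN.
pose t := tperm (lshift k p) (rshift k p).
have oddt : odd_perm t by rewrite odd_tperm eq_lrshift.
rewrite (reindex_inj (mulgI t)); apply: eq_big => [s|s].
  by rewrite odd_permM oddt.
rewrite odd_permM oddt /= => odds; rewrite (negbTE odds) mulN1r mul1r; congr -%R.
apply: eq_bigr => i _; rewrite !permM.
have [->|neq] := eqVneq i p; first by rewrite tpermL tpermR -[in LHS]symB mxE.
by rewrite !tpermD // ?eq_lrshift ?eq_rlshift // (inj_eq (@lshift_inj _ _), inj_eq (@rshift_inj _ _)) eq_sym.
Qed.

(* k! times the Pfaffian of B - B^T only depends on B modulo symmetric matrices. *)
Lemma pair_sum_congr_sym (B D : 'M[R]_(k + k)) :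
  (B - D)^T = B - D -> pair_sum (fun=> B) = pair_sum (fun=> D).
Proof.
move=> symBD.
(* Each factor is split as D + (B - D), and J collects the pairs that take D. Every J but the full
   set leaves a symmetric factor, which kills its term. *)
have -> : pair_sum (fun=> B) =
    \sum_(J in {set 'I_k}) pair_sum (fun i => if i \in J then D else B - D).
  rewrite exchange_big /=; apply: eq_bigr => s _; rewrite -mulr_sumr; congr (_ * _).
  transitivity (\prod_(i < k) (D (s (lshift k i)) (s (rshift k i)) +
                  (B - D) (s (lshift k i)) (s (rshift k i)))).
    by apply: eq_bigr => i _; rewrite !mxE; ring.
  rewrite bigA_distr; apply: eq_bigr => J _; apply: eq_bigr => i _.
  by case: ifP.
rewrite (bigD1 [set: 'I_k]) //= [X in _ + X]big1 ?addr0 => [|J].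
  by apply: eq_bigr => s _; congr (_ * _); apply: eq_bigr => i _; rewrite inE.
move=> neqJ.
have /existsP[p notJp] : [exists p, p \notin J].
  rewrite -negb_forall; apply: contra neqJ => /forallP allJ.
  by apply/eqP/setP => i; rewrite inE; apply: allJ.
by apply: (@pair_sum_sym _ p); rewrite (negbTE notJp).
Qed.

Definition pair_det L (X Y : 'M[R]_(L, k + k)) (f : 'I_k -> 'I_L) : R :=
  \det (col_mx (rowsub f X) (rowsub f Y)).

(** A variant of Cauchy-Binet: f is unrestricted, so the sum over f of a product over i becomes a
    product of sums, each of which is an entry of [X^T *m Y]. *)
Lemma sum_pair_det L (X Y : 'M[R]_(L, k + k)) :
  \sum_(f : {ffun 'I_k -> 'I_L}) pair_det X Y f = pair_sum (fun=> X^T *m Y).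
Proof.
rewrite exchange_big /=; apply: eq_bigr => s _; rewrite -mulr_sumr; congr (_ * _).
transitivity (\sum_(f : {ffun 'I_k -> 'I_L})
    \prod_(i < k) (X (f i) (s (lshift k i)) * Y (f i) (s (rshift k i)))).
  apply: eq_bigr => f _; rewrite big_split_ord big_split /=; congr (_ * _).
    by apply: eq_bigr => i _; rewrite col_mxEu mxE.
  by apply: eq_bigr => i _; rewrite col_mxEd mxE.
rewrite -(bigA_distr_bigA (fun i u => X u (s (lshift k i)) * Y u (s (rshift k i)))).
by apply: eq_bigr => i _; rewrite mxE; apply: eq_bigr => u _; rewrite mxE.
Qed.

Lemma pair_sum_block (D : 'M[R]_k) :
  pair_sum (fun=> block_mx 0 D 0 0) = k`!%:R * \det D.
Proof.
(* With this factorization [sum_pair_det] applies backwards: each of the k! bijections f contributes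
   det D times the square of a sign, and every other f contributes 0. *)
have <- : (row_mx 1%:M 0 : 'M[R]_(k, k + k))^T *m (row_mx (0 : 'M[R]_k) D) = block_mx 0 D 0 0.
  by rewrite tr_row_mx trmx1 trmx0 mul_col_row !mul1mx !mul0mx.
have detE (f : 'I_k -> 'I_k) : pair_det (row_mx 1%:M 0) (row_mx 0 D) f =
    \det (rowsub f 1%:M : 'M[R]_k) ^+ 2 * \det D.
  have subE (A B : 'M[R]_k) : rowsub f (row_mx A B) = row_mx (rowsub f A) (rowsub f B).
    apply/matrixP => i j; rewrite !mxE; case: (split j) => c; by rewrite !mxE.
  have sub0 : rowsub f (0 : 'M[R]_k) = 0 by apply/matrixP => i j; rewrite !mxE.
  rewrite /pair_det !subE sub0 -block_mxEv det_ublock (rowsubE f D) det_mulmx.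
  by rewrite expr2 mulrA.
rewrite -sum_pair_det (bigID (fun f : {ffun 'I_k -> 'I_k} => injectiveb f)) /=.
rewrite [X in _ + X]big1 ?addr0 => [|f]; last first.
  move=> /injectivePn[i [j neq_ij eq_f]].
  rewrite detE [X in X ^+ 2](determinant_alternate neq_ij) ?expr0n ?mul0r //.
  by move=> c; rewrite !mxE eq_f.
rewrite (eq_bigr (fun=> \det D)) => [|f /injectiveP inj_f].
  rewrite sumr_const -[LHS]mulr_natl; congr (_%:R * _).
  rewrite -[in RHS](ffactnn k).
  have := card_inj_ffuns 'I_k 'I_k; rewrite !card_ord => <-.
  by apply: eq_card => f; rewrite !inE.
rewrite detE; have -> : rowsub f 1%:M = perm_mx (perm inj_f) :> 'M[R]_k.
  by apply/matrixP => i j; rewrite !mxE permE.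
by rewrite det_perm sqrr_sign mul1r.
Qed.
End PairDeterminants.

(** Non-injective functions contribute nothing, and the injective ones with image U are the k!
    rearrangements of the enumeration of U. *)
Lemma sum_ffun_inj (V : nmodType) (k L : nat) (x0 : 'I_L) (w : ('I_k -> 'I_L) -> V) :
    (forall f g, f =1 g -> w f = w g) ->
    (forall f i j, i != j -> f i = f j -> w f = 0) ->
    (forall f (s : 'S_k), w (f \o s) = w f) ->
  \sum_(f : {ffun 'I_k -> 'I_L}) w f =
    (\sum_(U : {set 'I_L} | #|U| == k) w (fun i => nth x0 (enum U) i)) *+ k`!.
Proof.
move=> w_ext w_alt w_perm.
rewrite (bigID (fun f : {ffun 'I_k -> 'I_L} => injectiveb f)) /=.
rewrite [X in _ + X]big1 ?addr0 => [|f]; last first.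
  by move=> /injectivePn[i [j neq_ij eq_f]]; apply: w_alt neq_ij eq_f.
rewrite (partition_big (fun f : {ffun 'I_k -> 'I_L} => f @: 'I_k)
          (fun U : {set 'I_L} => #|U| == k)) /= => [|f /injectiveP inj_f]; last first.
  by rewrite card_imset // card_ord.
rewrite -sumrMnl; apply: eq_bigr => U /eqP cardU.
have sizeU : size (enum U) = k by rewrite -cardE.
pose e (i : 'I_k) := nth x0 (enum U) i.
have inj_e : injective e.
  move=> i j /eqP; rewrite /e nth_uniq ?sizeU ?ltn_ord ?enum_uniq //.
  by move/eqP/val_inj.
have memU x : (x \in U) = [exists i, x == e i].
  rewrite -mem_enum; apply/idP/existsP => [Ux|[i /eqP->]].
    have lt_ix : (index x (enum U) < k)%N by rewrite -[X in (_ < X)%N]sizeU index_mem.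
    by exists (Ordinal lt_ix); rewrite /e nth_index.
  by rewrite mem_nth // sizeU.
have im_e : e @: 'I_k = U.
  apply/setP => x; rewrite memU; apply/imsetP/existsP => [[i _ ->]|[i /eqP->]]; exists i => //.
pose h (s : 'S_k) := [ffun i => e (s i)].
have inj_h : injective h.
  by move=> s t /ffunP eq_h; apply/permP => i; have := eq_h i; rewrite !ffunE => /inj_e.
rewrite (eq_bigl (fun f => f \in [set h s | s : 'S_k])) => [|f]; last first.
  apply/andP/imsetP => [[/injectiveP inj_f /eqP im_f]|[s _ ->]].
    have ltf i : (index (f i) (enum U) < k)%N.
      by rewrite -[X in (_ < X)%N]sizeU index_mem mem_enum -im_f imset_f.
    have fE i : e (Ordinal (ltf i)) = f i.
      by rewrite /e nth_index // mem_enum -im_f imset_f.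
    have inj_s : injective (fun i => Ordinal (ltf i)).
      by move=> i j eq_s; apply: inj_f; rewrite -!fE eq_s.
    by exists (perm inj_s) => //; apply/ffunP => i; rewrite !ffunE permE fE.
  split; first by apply/injectiveP => i j; rewrite !ffunE => /inj_e/perm_inj.
  apply/eqP/setP => x; rewrite -im_e; apply/imsetP/imsetP => [[i _ ->]|[i _ ->]].
    by exists (s i); rewrite ?ffunE.
  by exists (s^-1%g i); rewrite // ffunE permKV.
rewrite big_imset /=; last by move=> s t _ _; apply: inj_h.
rewrite (eq_bigr (fun=> w e)) => [|s _]; last first.
  by rewrite -[RHS](w_perm e s); apply: w_ext => i; rewrite ffunE.
by rewrite sumr_const -[in RHS](card_Sn k); congr (_ *+ _); apply: eq_card => s; rewrite !inE.
Qed.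

(** A permutation of the chosen indices acts on both halves of the rows, so its sign occurs squared
    and [pair_det] depends only on the chosen subset. Both sides then carry the same factor k!. *)
Lemma sum_pair_det_subsets (R : idomainType) (k L : nat) (x0 : 'I_L)
    (X Y : 'M[R]_(L, k + k)) (D : 'M[R]_k) :
    (k`!)%:R != 0 :> R ->
    (X^T *m Y - block_mx 0 D 0 0)^T = X^T *m Y - block_mx 0 D 0 0 ->
  \sum_(U : {set 'I_L} | #|U| == k) pair_det X Y (fun i => nth x0 (enum U) i) = \det D.
Proof.
move=> fact_neq0 /pair_sum_congr_sym; rewrite -sum_pair_det pair_sum_block => sumE.
apply: (mulfI fact_neq0); rewrite -{}sumE mulr_natl; symmetry.
apply: (sum_ffun_inj x0) => [f g eq_fg|f i j neq_ij eq_f|f s].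
- by rewrite /pair_det; congr (\det (col_mx _ _)); apply/matrixP => i j; rewrite !mxE eq_fg.
- apply: (@determinant_alternate _ _ _ (lshift k i) (lshift k j)).
    by rewrite (inj_eq (@lshift_inj _ _)).
  by move=> c; rewrite !col_mxEu !mxE eq_f.
have permE (A : 'M[R]_(L, k + k)) : rowsub (f \o s) A = perm_mx s *m rowsub f A.
  by rewrite -row_permE; apply/matrixP => i j; rewrite !mxE.
rewrite /pair_det !permE -[X in col_mx X](addr0) -[X in col_mx _ X](add0r).
rewrite -{1}(mul0mx _ (rowsub f Y)) -{1}(mul0mx _ (rowsub f X)) -mul_block_col det_mulmx.
by rewrite det_ublock !det_perm -expr2 sqrr_sign mul1r.
Qed.

(** * Complete symmetric functions and Jacobi-Trudi determinants *)

Section CompleteSymmetric.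
Variables (R : comNzRingType) (x : nat -> R).

(** The coefficient of t^j in the product of (1 - x_i t)^-1 over i < N, one geometric series at a
    time. The variables are indexed by all of nat, so that induction on N stays in one ring. *)
Fixpoint complete_sym (N j : nat) : R :=
  if N is N'.+1 then \sum_(p < j.+1) x N' ^+ p * complete_sym N' (j - p)
  else (j == 0%N)%:R.

(* h_(a - b), read as 0 when a < b. *)
Definition complete_diff (N a b : nat) : R :=
  if (b <= a)%N then complete_sym N (a - b) else 0.

Lemma complete_sym0 N : complete_sym N 0 = 1.
Proof. by elim: N => //= N IHN; rewrite big_ord1 mul1r. Qed.

Lemma complete_symS N j :
  complete_sym N.+1 j.+1 = complete_sym N j.+1 + x N * complete_sym N.+1 j.
Proof.
rewrite [LHS]/= big_ord_recl mul1r subn0; congr (_ + _).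
rewrite [in RHS]/= mulr_sumr; apply: eq_bigr => p _.
by rewrite lift0 exprS mulrA subSS.
Qed.

Lemma complete_diffSS N a b : complete_diff N a.+1 b.+1 = complete_diff N a b.
Proof. by rewrite /complete_diff ltnS subSS. Qed.

Lemma complete_diff_add N a b c :
  complete_diff N (a + c) (b + c) = complete_diff N a b.
Proof. by elim: c => [|c IHc]; rewrite ?addn0 // !addnS complete_diffSS. Qed.

Lemma complete_diffS N a b : complete_diff N.+1 a.+1 b =
  complete_diff N a.+1 b + x N * complete_diff N.+1 a b.
Proof.
rewrite /complete_diff; have [le_ba|lt_ab] := leqP b a.
  by rewrite leqW // subSn // complete_symS.
have [le_ba|_] := leqP b a.+1; last by rewrite mulr0 addr0.
have -> : b = a.+1 by lia.
by rewrite subnn !complete_sym0 mulr0 addr0.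
Qed.

(** The recursion iterated d times. A row operation removes the leading term, and the sum that
    remains involves only entries in N variables. *)
Lemma complete_diff_telescope N a d b : complete_diff N.+1 (a + d) b =
  x N ^+ d * complete_diff N.+1 a b +
  \sum_(c < d) x N ^+ (d - c.+1) * complete_diff N (a + c).+1 b.
Proof.
elim: d => [|d IHd]; first by rewrite big_ord0 addn0 addr0 mul1r.
rewrite addnS complete_diffS IHd big_ord_recr /= subnn mul1r mulrDr.
have -> : \sum_(c < d) x N ^+ (d.+1 - c.+1) * complete_diff N (a + c).+1 b =
    x N * \sum_(c < d) x N ^+ (d - c.+1) * complete_diff N (a + c).+1 b.
  rewrite mulr_sumr; apply: eq_bigr => c _.
  by rewrite mulrA -exprS; congr (_ ^+ _ * _); have := ltn_ord c; lia.
by rewrite exprS; ring.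
Qed.

Definition jacobi_trudi (r N : nat) (lam : nat -> nat) : 'M[R]_r :=
  \matrix_(i, j) complete_diff N (lam i + j) i.

Lemma det_sum_rows r (I : finType) (w : 'I_r -> I -> R) (A : 'I_r -> I -> 'I_r -> R) :
  \det (\matrix_(i, j) \sum_c w i c * A i c j) =
  \sum_(f : {ffun 'I_r -> I}) (\prod_i w i (f i)) * \det (\matrix_(i, j) A i (f i) j).
Proof.
transitivity (\sum_(s : 'S_r) \sum_(f : {ffun 'I_r -> I})
    (-1) ^+ s * \prod_i (w i (f i) * A i (f i) (s i))).
  apply: eq_bigr => s _; rewrite -mulr_sumr; congr (_ * _).
  rewrite -(bigA_distr_bigA (fun i c => w i c * A i c (s i))).
  by apply: eq_bigr => i _; rewrite mxE.
rewrite exchange_big /=; apply: eq_bigr => f _; rewrite mulr_sumr.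
apply: eq_bigr => s _; rewrite big_split /= mulrCA; congr (_ * (_ * _)).
by apply: eq_bigr => i _; rewrite mxE.
Qed.

(** Equivalently, lam / f is a horizontal strip. *)
Definition interlacing r M (lam : nat -> nat) (f : {ffun 'I_r -> 'I_M}) :=
  [forall i : 'I_r, (lam i.+1 <= f i <= lam i)%N].

(* Subtracting x_N ^ (lam_i - lam_(i+1) + 1) times row i + 1 from row i leaves a
   geometric sum over lam_(i+1) <= c <= lam_i, so no cancellation is needed. *)
Lemma det_jacobi_trudi_branching r M N (lam : nat -> nat) :
    (forall i, lam i.+1 <= lam i)%N -> lam r = 0%N -> (lam 0%N <= M)%N ->
  \det (jacobi_trudi r N.+1 lam) =
  \sum_(f : {ffun 'I_r -> 'I_M.+1} | interlacing lam f)
    (\prod_(i < r) x N ^+ (lam i - f i)) * \det (\matrix_(i < r, j < r) complete_diff N (f i + j) i).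
Proof.
move=> decr lam_r lam_M.
have lam_le i : (lam i <= M)%N by elim: i => // i; apply: leq_trans.
pose T : 'M[R]_r := \matrix_(i, j) if j == i :> nat then 1 else
  if j == i.+1 :> nat then - x N ^+ (lam i - lam i.+1).+1 else 0.
have detT : \det T = 1.
  rewrite -det_tr det_trig; last first.
    apply/is_trig_mxP => i j lt_ij; rewrite !mxE.
    by case: eqP => [|_]; [lia | case: eqP => //; lia].
  by rewrite big1 // => i _; rewrite !mxE eqxx.
have -> : \det (jacobi_trudi r N.+1 lam) = \det (T *m jacobi_trudi r N.+1 lam).
  by rewrite det_mulmx detT mul1r.
pose w (i : 'I_r) (c : 'I_M.+1) : R :=
  if (lam i.+1 <= c <= lam i)%N then x N ^+ (lam i - c) else 0.
have -> : T *m jacobi_trudi r N.+1 lam =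
    \matrix_(i, j) \sum_c w i c * complete_diff N (c + j) i.
  apply/matrixP => i j; rewrite mxE [RHS]mxE.
  have -> : \sum_k T i k * jacobi_trudi r N.+1 lam k j =
      complete_diff N.+1 (lam i + j) i -
      x N ^+ (lam i - lam i.+1).+1 * complete_diff N.+1 (lam i.+1 + j) i.+1.
    rewrite (bigD1 i) //= !mxE eqxx mul1r; congr (_ + _).
    (* The last row has no row below it to subtract, but the entry that would be subtracted has the
       negative index j - r and is 0. *)
    have [lt_ir|ge_ir] := ltnP i.+1 r; last first.
      rewrite big1 => [|c neq]; last first.
        rewrite mxE (negbTE neq : (c == i :> nat) = false).
        by case: eqP => [|_]; [have := ltn_ord c; lia | rewrite mul0r].
      have -> : i.+1 = r by have := ltn_ord i; lia.
      by rewrite /complete_diff lam_r leqNgt ltn_ord mulr0 oppr0.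
    rewrite (bigD1 (Ordinal lt_ir)) /=; last by rewrite -val_eqE /= gtn_eqF.
    rewrite !mxE /= eqxx gtn_eqF // mulNr big1 ?addr0 // => c /andP[neq neq'].
    by rewrite mxE (negbTE neq : (c == i :> nat) = false) (negbTE neq' : (c == i.+1 :> nat) = false) mul0r.
  (* After this shift both entries have second argument [i.+1], and their first arguments differ by
     lam_i - lam_(i+1) + 1, the exponent in [T]. *)
  rewrite -complete_diffSS.
  have -> : (lam i + j).+1 = (lam i.+1 + j + (lam i - lam i.+1).+1)%N.
    by have := decr i; lia.
  rewrite complete_diff_telescope addrC addKr.
  rewrite /w -(big_mkord xpredT (fun c => x N ^+ ((lam i - lam i.+1).+1 - c.+1) *
    complete_diff N (lam i.+1 + j + c).+1 i.+1)).
  rewrite -(big_mkord xpredT (fun c => (if (lam i.+1 <= c <= lam i)%N then x N ^+ (lam i - c) else 0) *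
    complete_diff N (c + j) i)).
  rewrite [RHS](big_cat_nat _ (n := lam i.+1)) //=; last by have := lam_le i.+1; lia.
  rewrite [X in _ = X + _]big_nat [X in _ = X + _]big1 ?add0r => [|c /andP[_ lt_c]]; last first.
    by rewrite leqNgt lt_c mul0r.
  rewrite [RHS](big_cat_nat _ (n := (lam i).+1)) //=; last 2 first.
  - by rewrite leqW.
  - by rewrite ltnS.
  rewrite [X in _ + X]big_nat [X in _ + X]big1 ?addr0 => [|c /andP[lt_c _]]; last first.
    by rewrite andbC leqNgt lt_c mul0r.
  rewrite -[X in _ = \sum_(X <= _ < _) _]add0n big_addn.
  have -> : ((lam i).+1 - lam i.+1 = (lam i - lam i.+1).+1)%N by rewrite subSn.
  rewrite !big_nat; apply: eq_bigr => c /andP[_ lt_c].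
  rewrite complete_diffSS leq_addl /= ifT; last by have := decr i; lia.
  by congr (_ ^+ _ * complete_diff _ _ _); have := decr i; lia.
rewrite det_sum_rows [RHS]big_mkcond /=; apply: eq_bigr => f _.
case: ifP => [/forallP int_f|/negbT]; first congr (_ * _).
  by apply: eq_bigr => i _; rewrite /w int_f.
rewrite negb_forall => /existsP[i nint].
by rewrite (bigD1 i) //= /w (negbTE nint) !mul0r.
Qed.

End CompleteSymmetric.

(** * Tableaux *)

Lemma card_ord_interval M a b : (b <= M)%N ->
  #|[pred j : 'I_M | (a <= j < b)%N]| = (b - a)%N.
Proof.
move=> le_bM; rewrite -sum1_card; have [le_ab|lt_ba] := leqP a b; last first.
  by rewrite big_pred0 => [|j]; rewrite ?inE; lia.
rewrite (eq_bigl (fun j : 'I_M => (a <= j < b)%N)) => [|j]; last by rewrite inE.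
rewrite -(big_mkord (fun j => a <= j < b)%N (fun=> 1%N)).
rewrite (big_cat_nat _ (n := b)) //= [X in (_ + X)%N]big_nat_cond [X in (_ + X)%N]big_pred0 ?addn0; last by move=> j; lia.
rewrite (big_cat_nat _ (n := a)) //= big_nat_cond big_pred0 ?add0n; last by move=> j; lia.
rewrite big_nat_cond (eq_bigl (fun j => (a <= j < b)%N && true)) -?big_nat_cond; last by move=> j; lia.
by rewrite sum_nat_const_nat muln1.
Qed.

(** In a row of a tableau the entries below N form an initial segment, so their number determines
    where they are. This is how a shape is read off a filling. *)
Lemma initial_segment_card M (p : pred 'I_M) (j : 'I_M) :
  (forall i i' : 'I_M, (i < i')%N -> p i' -> p i) -> p j = (j < #|p|)%N.
Proof.
move=> closed_p; case pj: (p j); symmetry.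
  rewrite -[j.+1]subn0 -(card_ord_interval 0 (ltn_ord j)).
  apply/subset_leq_card/subsetP => i; rewrite inE /= ltnS leq_eqVlt => /orP[/eqP/val_inj->//|lt_ij].
  exact: closed_p lt_ij pj.
apply/negbTE; rewrite -leqNgt -[X in (_ <= X)%N]subn0 -(card_ord_interval 0 (ltnW (ltn_ord j))).
apply/subset_leq_card/subsetP => i pi; rewrite inE /= ltnNge leq_eqVlt.
apply/negP => /orP[/eqP/val_inj eq_ji|lt_ji]; first by rewrite eq_ji [p i]pi in pj.
by rewrite (closed_p _ _ lt_ji pi) in pj.
Qed.

(** The branching recursion takes shapes as functions on nat; the zeros from r on supply its
    condition [lam r = 0]. *)
Definition extend_by0 r M (f : {ffun 'I_r -> 'I_M}) (i : nat) : nat := if insub i is Some o then f o else 0%N.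

Lemma extend_by0_ord r M (f : {ffun 'I_r -> 'I_M}) (i : 'I_r) : extend_by0 f i = f i :> nat.
Proof. by rewrite /extend_by0 valK. Qed.

Lemma extend_by0_out r M (f : {ffun 'I_r -> 'I_M}) i : (r <= i)%N -> extend_by0 f i = 0%N.
Proof. by move=> le_ri; rewrite /extend_by0 insubN // -leqNgt. Qed.

Section BoxedTableaux.
Variables (R : comNzRingType) (x : nat -> R) (r M n : nat).
Implicit Types (lam : nat -> nat) (T : {ffun 'I_r * 'I_M -> 'I_n.+1}).

(* A tableau of shape lam with entries < N, extended to the whole r * M box by
   the value n, which has weight 1. *)
Definition boxed_tableau lam N T : bool :=
  [&& [forall c : 'I_r * 'I_M, if (c.2 < lam c.1)%N then (T c < N)%N else T c == n :> nat],
      [forall c : 'I_r * 'I_M, forall d : 'I_r * 'I_M, (c.1 == d.1) && (c.2 < d.2)%N ==> (T c <= T d)%N] &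
      [forall c : 'I_r * 'I_M, forall d : 'I_r * 'I_M,
         [&& (c.1 < d.1)%N, c.2 == d.2 & (d.2 < lam d.1)%N] ==> (T c < T d)%N]].

Lemma boxed_tableauP lam N T : reflect
  [/\ forall (i : 'I_r) (j : 'I_M), if (j < lam i)%N then is_true (T (i, j) < N)%N else T (i, j) = n :> nat,
      forall (i : 'I_r) (j j' : 'I_M), (j < j')%N -> (T (i, j) <= T (i, j'))%N &
      forall (i i' : 'I_r) (j : 'I_M), (i < i')%N -> (j < lam i')%N -> (T (i, j) < T (i', j))%N]
  (boxed_tableau lam N T).
Proof.
apply: (iffP and3P) => [[/forallP T1 /forallP T2 /forallP T3]|[T1 T2 T3]]; split.
- by move=> i j; have := T1 (i, j) => /=; case: ifP => // _ /eqP.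
- by move=> i j j' lt_j; have /forallP/(_ (i, j')) := T2 (i, j); rewrite /= eqxx lt_j.
- move=> i i' j lt_i lt_j; have /forallP/(_ (i', j)) := T3 (i, j).
  by rewrite /= eqxx lt_i lt_j.
- by apply/forallP => -[i j]; have := T1 i j => /=; case: ifP => // _ ->.
- apply/forallP => -[i j]; apply/forallP => -[i' j'] /=.
  by apply/implyP => /andP[/eqP<- /T2].
- apply/forallP => -[i j]; apply/forallP => -[i' j'] /=.
  by apply/implyP => /and3P[lt_i /eqP<- /(T3 _ _ _ lt_i)].
Qed.

Definition boxed_weight T : R := \prod_(c : 'I_r * 'I_M) (if (T c < n)%N then x (T c) else 1).

Definition boxed_shape N T : {ffun 'I_r -> 'I_M.+1} :=
  [ffun i => inord #|[pred j : 'I_M | (T (i, j) < N)%N]|].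

Lemma boxed_shape_eq lam N T (f : {ffun 'I_r -> 'I_M.+1}) : boxed_tableau lam N.+1 T ->
  (boxed_shape N T == f) = [forall c : 'I_r * 'I_M, (T c < N)%N == (c.2 < f c.1)%N].
Proof.
move=> /boxed_tableauP[T1 T2 T3].
have cardM (p : pred 'I_M) : (#|p| <= M)%N by rewrite -[X in (_ <= X)%N]card_ord max_card.
apply/eqP/forallP => [<- [i j]|eqT] /=.
  rewrite ffunE inordK ?ltnS ?cardM //.
  rewrite -(@initial_segment_card _ [pred j : 'I_M | (T (i, j) < N)%N]) //= => j1 j2 lt_j.
  exact/leq_ltn_trans/T2.
apply/ffunP => i; apply: val_inj; rewrite ffunE /= inordK ?ltnS ?cardM //.
rewrite -[RHS]subn0 -(@card_ord_interval M 0 (f i)) -1?ltnS //.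
by apply: eq_card => j; rewrite !inE /= (eqP (eqT (i, j))).
Qed.

(** By column strictness, an entry at most N in row i + 1 has an entry below N above it, so the
    entries equal to N form a horizontal strip. For the upper bound, the filler n just beyond row i
    is not below N. *)
Lemma boxed_shape_interlacing lam N T :
    (N < n)%N -> lam r = 0%N -> (forall i, lam i <= M)%N ->
  boxed_tableau lam N.+1 T -> interlacing lam (boxed_shape N T).
Proof.
move=> lt_Nn lam_r lam_M tabT; have := boxed_shape_eq (boxed_shape N T) tabT.
rewrite eqxx => /esym/forallP shapeT; have /boxed_tableauP[T1 T2 T3] := tabT.
set f := boxed_shape N T in shapeT *.
apply/forallP => i; apply/andP; split.
  have [lt_ir|] := ltnP i.+1 r; last first.
    move=> le_ri; have -> : i.+1 = r by have := ltn_ord i; lia.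
    by rewrite lam_r.
  case def_a: (lam i.+1) => [//|a].
  have lt_aM : (a < M)%N by rewrite -def_a.
  have /eqP/= <- := shapeT (i, Ordinal lt_aM).
  have := T3 i (Ordinal lt_ir) (Ordinal lt_aM) (leqnn _); rewrite /= def_a => /(_ (leqnn _)).
  have := T1 (Ordinal lt_ir) (Ordinal lt_aM); rewrite /= def_a leqnn; lia.
have [lt_aM|le_Ma] := ltnP (lam i) M; last first.
  by apply: leq_trans le_Ma; rewrite -ltnS.
have /eqP/= := shapeT (i, Ordinal lt_aM).
have := T1 i (Ordinal lt_aM); rewrite /= ltnn => ->.
by rewrite ltnNge ltnW //=; lia.
Qed.

Definition boxed_sum lam N : R := \sum_(T | boxed_tableau lam N T) boxed_weight T.

Lemma boxed_sum_branching lam N :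
    (N < n)%N -> (forall i, lam i.+1 <= lam i)%N -> lam r = 0%N -> (lam 0%N <= M)%N ->
  boxed_sum lam N.+1 = \sum_(f : {ffun 'I_r -> 'I_M.+1} | interlacing lam f)
    (\prod_(i < r) x N ^+ (lam i - f i)) * boxed_sum (extend_by0 f) N.
Proof.
move=> lt_Nn decr lam_r lam_M.
have lam_le i : (lam i <= M)%N by elim: i => // i; apply: leq_trans.
have lam_mono i i' : (i <= i')%N -> (lam i' <= lam i)%N.
  by move=> /subnK<-; elim: (i' - i)%N => // d; rewrite addSn; apply: leq_trans.
rewrite /boxed_sum (partition_big (boxed_shape N) (interlacing lam)) /=; last first.
  by move=> T; apply: boxed_shape_interlacing.
apply: eq_bigr => f /forallP intf.
have f_lam (i i' : 'I_r) : (i < i')%N -> (lam i' <= f i)%N.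
  by move=> /lam_mono/leq_trans; apply; have /andP[] := intf i.
(* [h] fills the strip lam / f with N, and [h'] resets every cell outside f to the filler n. The
   condition h' (h T) = T that the reindexing adds says that T already has the filler outside f. *)
pose h (T : {ffun 'I_r * 'I_M -> 'I_n.+1}) := [ffun c : 'I_r * 'I_M =>
  if (f c.1 <= c.2 < lam c.1)%N then inord N else T c].
pose h' (T : {ffun 'I_r * 'I_M -> 'I_n.+1}) := [ffun c : 'I_r * 'I_M =>
  if (c.2 < f c.1)%N then T c else ord_max].
rewrite (eq_bigl (fun T => boxed_tableau lam N.+1 T &&
          [forall c : 'I_r * 'I_M, (T c < N)%N == (c.2 < f c.1)%N])) => [|T]; last first.
  by case: (boolP (boxed_tableau _ _ _)) => // /boxed_shape_eq ->.
have hE T (i : 'I_r) (j : 'I_M) : h T (i, j) = (if (f i <= j < lam i)%N then N else T (i, j)) :> nat.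
  by rewrite ffunE /=; case: ifP => // _; rewrite inordK // ltnW.
have h'E T (i : 'I_r) (j : 'I_M) : h' T (i, j) = (if (j < f i)%N then T (i, j) : nat else n) :> nat.
  by rewrite ffunE /=; case: ifP.
rewrite (reindex_onto h h') => [|T /andP[/boxed_tableauP[T1 T2 T3] /forallP shT]]; last first.
  apply/ffunP => -[i j]; apply: val_inj => /=; rewrite hE h'E.
  have := T1 i j; have /eqP/= := shT (i, j); have /andP[] := intf i.
  by case: (ltnP j (f i)); case: (ltnP j (lam i)) => //= *; lia.
rewrite mulr_sumr; apply: eq_big => [T|T].
  apply/andP/boxed_tableauP => [[/andP[/boxed_tableauP[T1 T2 T3] /forallP shT] /eqP hK]|[T1 T2 T3]].
    have TE (i : 'I_r) (j : 'I_M) : (j < f i)%N -> h T (i, j) = T (i, j) :> nat.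
      by rewrite hE => lt_jf; rewrite leqNgt lt_jf.
    have Tn (i : 'I_r) (j : 'I_M) : (f i <= j)%N -> T (i, j) = n :> nat.
      by move=> le_fj; rewrite -[in LHS]hK h'E ltnNge le_fj.
    split=> [i j|i j j' lt_j|i i' j lt_i].
    - rewrite extend_by0_ord; case: ltnP => [lt_jf|/Tn//].
      by rewrite -TE //; have /eqP-> := shT (i, j).
    - have [lt_j'f|/Tn->] := ltnP j' (f i); last by rewrite -ltnS.
      by rewrite -!TE //; [apply: T2 | lia].
    rewrite extend_by0_ord => lt_jf; have /andP[_ le_f] := intf i'; have := f_lam _ _ lt_i.
    by move=> le_lam; rewrite -!TE; [apply: T3 => //| |]; lia.
  have Tin (i : 'I_r) (j : 'I_M) : (j < f i)%N -> (T (i, j) < N)%N.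
    by have := T1 i j; rewrite extend_by0_ord; case: ltnP.
  have Tout (i : 'I_r) (j : 'I_M) : (f i <= j)%N -> T (i, j) = n :> nat.
    by have := T1 i j; rewrite extend_by0_ord; case: ltnP.
  split; last first.
    apply/eqP/ffunP => -[i j]; apply: val_inj => /=; rewrite h'E hE.
    by case: ltnP => //= /Tout.
  apply/andP; split; last first.
    apply/forallP => -[i j] /=; rewrite hE; have := Tin i j; have := Tout i j.
    by case: (ltnP j (f i)) => [_ _ /(_ isT)->//|? /(_ isT)-> _] /=; case: ifP => _; apply/eqP; lia.
  apply/boxed_tableauP; split=> [i j|i j j' lt_j|i i' j lt_i lt_j]; rewrite !hE.
  - have := Tin i j; have := Tout i j; have /andP[] := intf i.
    by case: (ltnP j (f i)); case: (ltnP j (lam i)) => //= *; lia.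
  - have := Tin i j; have := Tout i j; have := Tin i j'; have := Tout i j'; have /andP[] := intf i.
    have := T2 i j j' lt_j; have := ltn_ord (T (i, j)).
    by case: (ltnP j (f i)); case: (ltnP j (lam i)); case: (ltnP j' (f i)); case: (ltnP j' (lam i)) => //= *; lia.
  - have := f_lam _ _ lt_i; have := Tin i j; have := T3 i i' j lt_i.
    rewrite extend_by0_ord lt_j.
    by case: (ltnP j (f i)); case: (ltnP j (f i')) => //= *; lia.
move=> /andP[_ /eqP hK].
have Tn (i : 'I_r) (j : 'I_M) : (f i <= j)%N -> T (i, j) = n :> nat.
  by move=> le_fj; rewrite -[in LHS]hK h'E ltnNge le_fj.
(* On the strip T carries the filler, of weight 1, where [h T] carries N: the two weights differ by
   one factor x_N per strip cell. *)
transitivity (\prod_(c : 'I_r * 'I_M) ((if (f c.1 <= c.2 < lam c.1)%N then x N else 1) *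
    (if (T c < n)%N then x (T c) else 1))).
  apply: eq_bigr => -[i j] _; rewrite hE /=.
  case: (boolP (f i <= j < lam i)%N) => [/andP[le_fj _]|_]; first by rewrite lt_Nn Tn // ltnn mulr1.
  by rewrite mul1r.
rewrite big_split /=; congr (_ * _).
rewrite -(pair_bigA _ (fun (i : 'I_r) (j : 'I_M) => if (f i <= j < lam i)%N then x N else 1)) /=.
apply: eq_bigr => i _; rewrite -big_mkcond /= prodr_const; congr (_ ^+ _).
by rewrite -(card_ord_interval (f i) (lam_le i)); apply: eq_card => j; rewrite !inE.
Qed.

(** Both sides obey the same branching recursion in the number of variables. With no variables, a
    nonempty shape has no tableau and a zero first row, while the empty shape gives one constant
    filling and the identity matrix. *)
Lemma boxed_sum_jacobi_trudi lam N :
    (N <= n)%N -> (forall i, lam i.+1 <= lam i)%N -> lam r = 0%N -> (lam 0%N <= M)%N ->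
  boxed_sum lam N = \det (jacobi_trudi x r N lam).
Proof.
elim: N lam => [|N IHN] lam le_Nn decr lam_r lam_M.
  have lam_mono i i' : (i <= i')%N -> (lam i' <= lam i)%N.
    by move=> /subnK<-; elim: (i' - i)%N => // d; rewrite addSn; apply: leq_trans.
  have [lam0|lam_gt0] := posnP (lam 0%N).
    have lamE i : lam i = 0%N by have := lam_mono 0%N i isT; lia.
    have -> : jacobi_trudi x r 0 lam = 1%:M.
      apply/matrixP => i j; rewrite !mxE lamE add0n /complete_diff -val_eqE eq_sym /=.
      by rewrite subn_eq0; case: ltngtP.
    rewrite det1 /boxed_sum (big_pred1 [ffun=> ord_max]) => [|T].
      by rewrite /boxed_weight big1 // => c _; rewrite ffunE /= ltnn.
    apply/boxed_tableauP/eqP => [[T1 _ _]|->].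
      by apply/ffunP => -[i j]; apply: val_inj; rewrite ffunE /=; have := T1 i j; rewrite lamE.
    by split=> [i j|i j j'|i i' j]; rewrite ?lamE !ffunE.
  have r_gt0 : (0 < r)%N by rewrite lt0n; apply/eqP => r0; rewrite -r0 lam_r in lam_gt0.
  have M_gt0 : (0 < M)%N by apply: leq_trans lam_M.
  rewrite (expand_det_row _ (Ordinal r_gt0)) [RHS]big1 => [|j _]; last first.
    by rewrite mxE /complete_diff subn0 /= addn_eq0 gtn_eqF ?mul0r.
  rewrite /boxed_sum big_pred0 // => T; apply/negP => /boxed_tableauP[T1 _ _].
  by have := T1 (Ordinal r_gt0) (Ordinal M_gt0); rewrite lam_gt0.
rewrite boxed_sum_branching // (det_jacobi_trudi_branching _ _ decr lam_r lam_M).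
apply: eq_bigr => f /forallP intf; congr (_ * _).
have fE (i : 'I_r) : extend_by0 f i = f i :> nat by rewrite extend_by0_ord.
rewrite IHN; first 1 last.
- exact: ltnW.
- move=> i; have [lt_ir|le_ri] := ltnP i.+1 r; last by rewrite extend_by0_out.
  rewrite (fE (Ordinal lt_ir)) (fE (Ordinal (ltnW lt_ir))).
  have /andP[_ le1] := intf (Ordinal lt_ir); have /andP[le2 _] := intf (Ordinal (ltnW lt_ir)).
  exact: leq_trans le1 le2.
- exact: extend_by0_out.
- have [r0|r_gt0] := posnP r; first by rewrite extend_by0_out ?r0.
  by rewrite (fE (Ordinal r_gt0)) -ltnS.
by congr (\det _); apply/matrixP => i j; rewrite !mxE fE.
Qed.

End BoxedTableaux.

(** * From fillings of the diagram to fillings of the box *)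

Section TableauxInBox.
Variables (R : comNzRingType) (x : nat -> R) (lam : seq nat) (n : nat).
Hypothesis lam_sorted : sorted geq lam.
Local Notation r := (size lam).
Local Notation M := (nth 0%N lam 0).
Local Notation row := (nth 0%N lam).

Lemma row_mono i i' : (i <= i')%N -> (row i' <= row i)%N.
Proof.
move=> le_i; have [lt_ir|le_ri] := ltnP i' r; last by rewrite nth_default.
apply: (@sorted_leq_nth _ geq _ _ 0%N lam lam_sorted i i') => //.
- by move=> a b c /= ab bc; apply: leq_trans bc ab.
- exact: leqnn.
by rewrite inE (leq_ltn_trans le_i).
Qed.

Definition mk_cell (i : 'I_r) (j : nat) (lt_j : (j < row i)%N) : cell lam :=
  Tagged (fun i : 'I_r => 'I_(row i)) (Ordinal lt_j).

Definition cell_pos (c : cell lam) : 'I_r * 'I_M :=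
  (tag c, widen_ord (row_mono (leq0n (tag c))) (tagged c)).

Definition box_tableau (T : {ffun cell lam -> 'I_n}) : {ffun 'I_r * 'I_M -> 'I_n.+1} :=
  [ffun c : 'I_r * 'I_M => if insub (val c.2) is Some j
             then widen_ord (leqnSn n) (T (Tagged (fun i : 'I_r => 'I_(row i)) (j : 'I_(row c.1))))
             else ord_max].

Lemma box_tableau_in T (i : 'I_r) (j : 'I_M) (lt_j : (j < row i)%N) :
  box_tableau T (i, j) = T (mk_cell lt_j) :> nat.
Proof. by rewrite ffunE /= insubT. Qed.

Lemma box_tableau_out T (i : 'I_r) (j : 'I_M) :
  (row i <= j)%N -> box_tableau T (i, j) = n :> nat.
Proof. by move=> le_j; rewrite ffunE /= insubN // -leqNgt. Qed.

Lemma box_tableau_pos T c : box_tableau T (cell_pos c) = T c :> nat.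
Proof.
case: c => i [j lt_j].
exact: (@box_tableau_in T i (widen_ord (row_mono (leq0n i)) (Ordinal lt_j)) lt_j).
Qed.

Lemma cell_pos_inj : injective cell_pos.
Proof.
case=> i j [i' j'] /= [eq_i eq_j]; case: _ / eq_i j' eq_j => j' eq_j.
by congr existT; apply: val_inj.
Qed.

Lemma box_tableau_inj : injective box_tableau.
Proof.
move=> T T' eqT; apply/ffunP => c; apply: val_inj.
by rewrite /= -!box_tableau_pos eqT.
Qed.

Lemma semistandard_boxed T : semistandard T = boxed_tableau row n (box_tableau T).
Proof.
apply/forallP/boxed_tableauP => [ssT|[T1 T2 T3] c].
  split=> [i j|i j j' lt_j|i i' j lt_i lt_j].
  - by case: ltnP => [lt_j|/box_tableau_out->//]; rewrite box_tableau_in.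
  - have [lt_j'i|/box_tableau_out->] := ltnP j' (row i); last by rewrite -ltnS.
    have lt_ji := ltn_trans lt_j lt_j'i.
    rewrite (box_tableau_in _ lt_ji) (box_tableau_in _ lt_j'i).
    have /forallP/(_ (mk_cell lt_j'i))/andP[] := ssT (mk_cell lt_ji).
    by rewrite /= eqxx lt_j.
  have lt_ji : (j < row i)%N by apply: leq_trans lt_j (row_mono (ltnW lt_i)).
  rewrite (box_tableau_in _ lt_ji) (box_tableau_in _ lt_j).
  have /forallP/(_ (mk_cell lt_j))/andP[_] := ssT (mk_cell lt_ji).
  by rewrite /= eqxx lt_i.
apply/forallP => d; rewrite -!box_tableau_pos; apply/andP; split; apply/implyP.
  case/andP => /eqP eq_i lt_j; 
  have -> : cell_pos d = ((cell_pos c).1, (cell_pos d).2) by rewrite /= eq_i.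
  apply: T2; exact: lt_j.
case/andP => lt_i /eqP eq_j.
have -> : cell_pos c = ((cell_pos c).1, (cell_pos d).2).
  by congr pair; apply: val_inj; rewrite /= eq_j.
apply: T3 => //=; exact: ltn_ord.
Qed.

Lemma box_tableau_onto T : boxed_tableau row n T -> exists T', T = box_tableau T'.
Proof.
move=> /boxed_tableauP[T1 _ _].
have ltT c : (T (cell_pos c) < n)%N.
  by have := T1 (cell_pos c).1 (cell_pos c).2; rewrite /= ltn_ord.
exists [ffun c => Ordinal (ltT c)]; apply/ffunP => -[i j]; apply: val_inj => /=.
have := T1 i j; case: ltnP => [lt_j _|le_j ->]; last by rewrite box_tableau_out.
rewrite (box_tableau_in _ lt_j) ffunE /=; congr (nat_of_ord (T (_, _))).
exact: val_inj.
Qed.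

Lemma boxed_weight_box T : boxed_weight x (box_tableau T) = \prod_(c : cell lam) x (T c).
Proof.
rewrite /boxed_weight (bigID (fun c => c \in cell_pos @: [set: cell lam])) /=.
rewrite [X in _ * X]big1 ?mulr1 => [|[i j] /imsetP notin]; last first.
  rewrite box_tableau_out ?ltnn // leqNgt; apply/negP => lt_j; apply: notin.
  by exists (mk_cell lt_j); rewrite ?inE //; congr pair; apply: val_inj.
rewrite (eq_bigl (fun c => c \in cell_pos @: [set: cell lam])) //.
rewrite big_imset /=; last by move=> c d _ _; apply: cell_pos_inj.
by apply: eq_big => [c|c _]; rewrite ?inE // box_tableau_pos ltn_ord.
Qed.

(** The values x are arbitrary: the indeterminates give the Schur polynomial and their squares give
    its plethysm, so one formula serves both sides of the theorem. *)
Lemma tableau_sum_jacobi_trudi :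
  \sum_(T : {ffun cell lam -> 'I_n} | semistandard T) \prod_(c : cell lam) x (T c)
  = \det (jacobi_trudi x r n row).
Proof.
rewrite -(@boxed_sum_jacobi_trudi _ x r M n row n) //; first last.
- by rewrite nth_default.
- by move=> i; apply: row_mono.
rewrite /boxed_sum (eq_bigl (fun T => T \in box_tableau @: [set T | semistandard T])); last first.
  move=> T; apply/idP/imsetP => [tabT|[T']].
    have [T' eqT] := box_tableau_onto tabT; exists T' => //.
    by rewrite inE semistandard_boxed -eqT.
  by rewrite inE semistandard_boxed => ? ->.
rewrite big_imset /=; last by move=> T T' _ _; apply: box_tableau_inj.
by apply: eq_big => [T|T _]; rewrite ?inE // boxed_weight_box.
Qed.

End TableauxInBox.

Definition mpoly_var (n i : nat) : {mpoly int[n]} :=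
  if insub i is Some o then 'X_(o : 'I_n) else 0.

Lemma mpoly_var_ord n (i : 'I_n) : mpoly_var n i = 'X_i.
Proof. by rewrite /mpoly_var valK. Qed.

Lemma schur_jacobi_trudi (lam : seq nat) n : sorted geq lam ->
  schur lam n = \det (jacobi_trudi (mpoly_var n) (size lam) n (nth 0%N lam)).
Proof.
move=> lam_sorted; rewrite -tableau_sum_jacobi_trudi //.
by apply: eq_bigr => T _; apply: eq_bigr => c _; rewrite mpoly_var_ord.
Qed.

Lemma plethysm_p2_schur_jacobi_trudi (lam : seq nat) n : sorted geq lam ->
  plethysm_p2 (schur lam) n =
  \det (jacobi_trudi (fun i => mpoly_var n i ^+ 2) (size lam) n (nth 0%N lam)).
Proof.
move=> lam_sorted; rewrite -tableau_sum_jacobi_trudi // /plethysm_p2 /schur.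
rewrite rmorph_sum; apply: eq_bigr => T _; rewrite rmorph_prod; apply: eq_bigr => c _.
by rewrite mpoly_var_ord /= comp_mpolyXU -tnth_nth tnth_mktuple.
Qed.

(** * Complete symmetric functions of the squares *)

Section Convolution.
Variable R : comNzRingType.
Implicit Types (a b : nat -> R).

Definition convolution a b (j : nat) : R := \sum_(p < j.+1) a p * b (j - p)%N.

Lemma convolutionC a b j : convolution a b j = convolution b a j.
Proof.
rewrite /convolution (reindex_inj rev_ord_inj) /=; apply: eq_bigr => p _.
by rewrite mulrC subSS subKn // -ltnS.
Qed.

Lemma convolution_geom a a' b y j :
    a' 0%N = a 0%N -> (forall p, a' p.+1 = a p.+1 + y * a' p) ->
  convolution a' b j.+1 = convolution a b j.+1 + y * convolution a' b j.
Proof.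
move=> a'0 a'S; rewrite /convolution big_ord_recl [in RHS]big_ord_recl a'0 -addrA.
congr (_ + _); rewrite mulr_sumr -big_split; apply: eq_bigr => p _.
by rewrite lift0 a'S subSS mulrDl mulrA.
Qed.

Variable x : nat -> R.

Definition alternating_square N : nat -> R :=
  convolution (fun p => (-1) ^+ p * complete_sym x N p) (complete_sym x N).

(* The generating function of complete_sym satisfies
   H(-t) H(t) = prod_i (1 - x_i ^ 2 t ^ 2) ^ -1. *)
Lemma alternating_squareE N j : alternating_square N j =
  if odd j then 0 else complete_sym (fun i => x i ^+ 2) N j./2.
Proof.
elim: N j => [|N IHN] j.
  rewrite /alternating_square /convolution big_ord_recl subn0 expr0 !mul1r big1 ?addr0 => [|p _].
    by case: j => [|[|j]] //=; rewrite if_same.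
  by rewrite lift0 mulr0 mul0r.
have recE i : alternating_square N.+1 i.+2 =
    alternating_square N i.+2 + x N ^+ 2 * alternating_square N.+1 i.
  pose h := complete_sym x N; pose h' := complete_sym x N.+1.
  pose a p := (-1) ^+ p * h p; pose a' p := (-1) ^+ p * h' p.
  have hS p : h' p.+1 = h p.+1 + x N * h' p by apply: complete_symS.
  have h0 : h' 0%N = h 0%N by rewrite /h /h' !complete_sym0.
  have aS p : a' p.+1 = a p.+1 + - x N * a' p by rewrite /a /a' hS exprS; ring.
  have a0 : a' 0%N = a 0%N by rewrite /a /a' h0.
  rewrite -[LHS]/(convolution a' h' _) -[X in _ = _ + _ * X]/(convolution a' h' _).
  rewrite -[X in _ = X + _]/(convolution a h _).
  (* The new variable divides H(-t) by 1 + x_N t and H(t) by 1 - x_N t. [E1] and [E3] use the first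
     fact and [E2] the second; the mixed terms [convolution a h'] cancel, which leaves the factor 1
     - x_N^2 t^2. *)
  have E1 := convolution_geom h' i.+1 a0 aS; have E3 := convolution_geom h' i a0 aS.
  have E2 : convolution a h' i.+2 = convolution a h i.+2 + x N * convolution a h' i.+1.
    by rewrite convolutionC (convolution_geom _ _ h0 hS) !(convolutionC _ a).
  by rewrite E1 E2 E3; ring.
have [n] := ubnP j; elim: n j => // n IHn [|[|j]] lt_jn.
- by rewrite /alternating_square /convolution big_ord1 subnn !complete_sym0 !mulr1.
- rewrite /alternating_square /convolution big_ord_recl big_ord1 lift0 [RHS]/=.
  by rewrite [val ord0]/= subnn subn0 complete_sym0 expr0 expr1; ring.
rewrite recE IHN IHn; last by lia.
have -> : odd j.+2 = odd j by rewrite /= negbK.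
have -> : j.+2./2 = j./2.+1 by [].
case: odd; first by rewrite mulr0 addr0.
by rewrite complete_symS.
Qed.

(** The summand vanishes for c < a and for c + b > D. The inductions on a and b peel off these end
    terms, and moving the start of the range from a to 0 costs (-1)^a. *)
Lemma alternating_diff_sum N D (a b : nat) :
  \sum_(c < D.+1) (-1) ^+ c * complete_diff x N c a * complete_diff x N (D - c) b =
  (-1) ^+ a * (if (a + b <= D)%N then alternating_square N (D - (a + b)) else 0).
Proof.
elim: a D => [|a IHa] D; last first.
  case: D => [|D]; first by rewrite big_ord1 /complete_diff mulr0 mul0r addSn mulr0.
  rewrite big_ord_recl {1}/complete_diff mulr0 mul0r add0r.
  transitivity (- \sum_(c < D.+1) (-1) ^+ c * complete_diff x N c a * complete_diff x N (D - c) b).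
    rewrite -sumrN; apply: eq_bigr => c _.
    by rewrite lift0 complete_diffSS subSS exprS; ring.
  by rewrite IHa addSn ltnS subSS exprS; ring.
rewrite expr0 mul1r add0n; elim: b D => [|b IHb] D.
  rewrite subn0; apply: eq_bigr => c _; rewrite /complete_diff !subn0 //.
case: D => [|D]; first by rewrite big_ord1 /complete_diff mulr0.
rewrite big_ord_recr /= subnn [X in _ * X]/complete_diff mulr0 addr0 ltnS subSS -IHb.
by apply: eq_bigr => c _; rewrite subSn ?complete_diffSS // -ltnS.
Qed.

End Convolution.

(** * Signs of sequences *)

Section SequenceSign.
Implicit Types s t : seq nat.

Definition pair_sign (a b : nat) : int := Num.sg (b%:Z - a%:Z).

Definition cross_sign s t : int := \prod_(a <- s) \prod_(b <- t) pair_sign a b.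

(** For distinct entries this is -1 to the number of inversions; a repeated entry gives 0. Signs of
    words can thus be computed block by block, without naming a permutation. *)
Fixpoint seq_sign s : int :=
  if s is a :: s' then (\prod_(b <- s') pair_sign a b) * seq_sign s' else 1.

Lemma pair_sign_lt a b : (a < b)%N -> pair_sign a b = 1.
Proof. by move=> lt_ab; rewrite /pair_sign gtr0_sg // subr_gt0 ltz_nat. Qed.

Lemma pair_sign_gt a b : (b < a)%N -> pair_sign a b = -1.
Proof. by move=> lt_ba; rewrite /pair_sign ltr0_sg // subr_lt0 ltz_nat. Qed.

Lemma pair_signC a b : pair_sign b a = - pair_sign a b.
Proof. by rewrite /pair_sign -sgrN opprB. Qed.

Lemma seq_sign_cat s t : seq_sign (s ++ t) = seq_sign s * seq_sign t * cross_sign s t.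
Proof.
rewrite /cross_sign; elim: s => [|a s IHs] /=; first by rewrite big_nil mulr1 mul1r.
by rewrite big_cat big_cons IHs /=; ring.
Qed.

Lemma seq_sign_incr s : sorted ltn s -> seq_sign s = 1.
Proof.
elim: s => //= a s IHs lt_s; rewrite IHs ?(path_sorted lt_s) // mulr1 big_seq big1 // => b b_s.
by rewrite pair_sign_lt //; have /allP/(_ _ b_s) := order_path_min ltn_trans lt_s.
Qed.

Lemma seq_sign_decr s : sorted gtn s -> seq_sign s = (-1) ^+ 'C(size s, 2).
Proof.
have gtn_trans : transitive gtn by move=> a b c /= ab bc; apply: ltn_trans bc ab.
elim: s => //= a s IHs gt_s; rewrite IHs ?(path_sorted gt_s) // binS bin1 exprD mulrC; congr (_ * _).
rewrite big_seq (eq_bigr (fun=> -1)) => [|b b_s]; last first.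
  by rewrite pair_sign_gt //; have /allP/(_ _ b_s) := order_path_min gtn_trans gt_s.
by rewrite -big_seq big_const_seq count_predT iter_mulr_1.
Qed.

Lemma seq_sign_ord s : seq_sign s =
  \prod_(i < size s) \prod_(j < size s | (i < j)%N) pair_sign (nth 0%N s i) (nth 0%N s j).
Proof.
elim: s => [|a s IHs] /=; first by rewrite big_ord0.
rewrite big_ord_recl /= [X in _ = X * _]big_mkcond big_ord_recl /= mul1r IHs.
rewrite (big_nth 0%N) big_mkord; congr (_ * _); apply: eq_bigr => i _.
by rewrite [RHS]big_mkcond big_ord_recl /= mul1r [LHS]big_mkcond.
Qed.

(** [seq_sign] is the sign of the Vandermonde determinant of the entries, and p permutes the columns
    of that determinant. *)
Lemma seq_sign_perm r (p : 'S_r) s t : size s = r -> size t = r ->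
    (forall i : 'I_r, nth 0%N s i = nth 0%N t (p i)) ->
  seq_sign s = (-1) ^+ p * seq_sign t.
Proof.
move=> size_s size_t eq_st.
pose v u : 'rV[int]_r := \row_i (nth 0%N u i)%:Z.
have signV u : size u = r -> seq_sign u = Num.sg (\det (Vandermonde r (v u))).
  move=> size_u; rewrite det_Vandermonde seq_sign_ord size_u (big_morph _ (@sgrM _) (@sgr1 _)); apply: eq_bigr => i _.
  by rewrite (big_morph _ (@sgrM _) (@sgr1 _)); apply: eq_bigr => j _; rewrite !mxE.
rewrite !signV //.
have -> : Vandermonde r (v s) = col_perm p (Vandermonde r (v t)).
  by apply/matrixP => i j; rewrite !mxE eq_st.
by rewrite col_permE det_mulmx det_perm odd_permV mulrC sgrM sgrX sgrN sgr1.
Qed.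

Lemma perm_eq_perm r s t : size s = r -> perm_eq s t ->
  exists p : 'S_r, forall i : 'I_r, nth 0%N s i = nth 0%N t (p i).
Proof.
move=> size_s eq_st; have size_t : size t = r by rewrite -(perm_size eq_st).
have st := introT eqP size_s; have tt := introT eqP size_t.
have /tuple_permP[p eq_s] : perm_eq (Tuple st) (Tuple tt) by [].
exists p => i; rewrite -[s]/(tval (Tuple st)) eq_s -[t]/(tval (Tuple tt)).
by rewrite -!tnth_nth tnth_mktuple.
Qed.

Lemma sqr_seq_sign s : uniq s -> seq_sign s ^+ 2 = 1.
Proof.
elim: s => [|a s IHs] //= /andP[a_s /IHs]; rewrite exprMn => ->; rewrite mulr1.
rewrite -prodrXl big_seq big1 // => b b_s; have [eq_ab|neq_ab] := eqVneq a b.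
  by rewrite eq_ab b_s in a_s.
rewrite /pair_sign sqr_sg subr_eq0.
by rewrite eqz_nat eq_sym neq_ab.
Qed.

(** As [seq_sign t] squares to 1, the product of the two signs is the sign of the permutation
    between s and t. The lemma is applied to rows and, after transposition, to columns. *)
Lemma det_nth_perm (R : comNzRingType) r (h : nat -> 'I_r -> R) s t :
    size s = r -> perm_eq s t -> uniq s ->
  \det (\matrix_(i < r, j < r) h (nth 0%N s i) j) =
  (seq_sign s * seq_sign t)%:~R * \det (\matrix_(i < r, j < r) h (nth 0%N t i) j).
Proof.
move=> size_s eq_st uniq_s; have size_t : size t = r by rewrite -(perm_size eq_st).
have [p eq_p] := perm_eq_perm size_s eq_st.
have -> : (\matrix_(i < r, j < r) h (nth 0%N s i) j) =
    row_perm p (\matrix_(i < r, j < r) h (nth 0%N t i) j).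
  by apply/matrixP => i j; rewrite !mxE eq_p.
rewrite row_permE det_mulmx det_perm; congr (_ * _).
rewrite (seq_sign_perm size_s size_t eq_p) -mulrA -expr2 sqr_seq_sign ?mulr1.
  by rewrite rmorphXn rmorphN1.
by rewrite -(perm_uniq eq_st).
Qed.

End SequenceSign.

(** * The expansion of the rectangle *)

Lemma signr_odd_eq (R : pzRingType) a b : odd a = odd b -> (-1) ^+ a = (-1) ^+ b :> R.
Proof. by move=> eq_ab; rewrite -signr_odd eq_ab signr_odd. Qed.

Lemma cross_sign_gt (s t : seq nat) :
  {in s & t, forall a b, (b < a)%N} -> cross_sign s t = (-1) ^+ (size s * size t).
Proof.
move=> gt_st; rewrite /cross_sign big_seq (eq_bigr (fun=> (-1) ^+ size t)) => [|a a_s].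
  by rewrite -big_seq big_const_seq count_predT iter_mulr_1 -exprM mulnC.
rewrite big_seq (eq_bigr (fun=> -1)) => [|b b_t]; last by rewrite pair_sign_gt ?gt_st.
by rewrite -big_seq big_const_seq count_predT iter_mulr_1.
Qed.

(** The column order in which the vanishing coefficients of omega, those at positions of equal
    parity, fill the two diagonal blocks. *)
Definition evens_odds (k : nat) : seq nat :=
  [seq j.*2 | j <- iota 0 k] ++ [seq j.*2.+1 | j <- iota 0 k].

Lemma size_evens_odds k : size (evens_odds k) = (k + k)%N.
Proof. by rewrite size_cat !size_map size_iota. Qed.

Lemma nth_evens k (j : 'I_k) : nth 0%N (evens_odds k) (lshift k j) = j.*2.
Proof. by rewrite nth_cat size_map size_iota /= ltn_ord (nth_map 0%N) ?size_iota ?nth_iota. Qed.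

Lemma nth_odds k (j : 'I_k) : nth 0%N (evens_odds k) (rshift k j) = j.*2.+1.
Proof.
rewrite nth_cat size_map size_iota /= ltnNge leq_addr /= addKn.
by rewrite (nth_map 0%N) ?size_iota ?nth_iota.
Qed.

Lemma uniq_evens_odds k : uniq (evens_odds k).
Proof.
rewrite cat_uniq !map_inj_uniq ?iota_uniq /= ?andbT; try by move=> i j; lia.
by apply/hasPn => _ /mapP[i _ ->]; apply/negP => /mapP[j _]; lia.
Qed.

Lemma perm_evens_odds k : perm_eq (evens_odds k) (iota 0 (k + k)).
Proof.
have sub : {subset evens_odds k <= iota 0 (k + k)}.
  by move=> a; rewrite mem_cat mem_iota => /orP[] /mapP[j]; rewrite mem_iota => ? ->; lia.
have [|_ eq_mem] := uniq_min_size (uniq_evens_odds k) sub.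
  by rewrite size_evens_odds size_iota.
by apply: uniq_perm; rewrite ?uniq_evens_odds ?iota_uniq.
Qed.

Lemma gtn_trans : transitive gtn.
Proof. by move=> a b c /= ab bc; apply: ltn_trans bc ab. Qed.

Lemma iota_index k : iota 0 k = index_iota 0 k.
Proof. by rewrite /index_iota subn0. Qed.

Lemma seq_sign_evens_odds k : seq_sign (evens_odds k) = (-1) ^+ 'C(k, 2).
Proof.
rewrite seq_sign_cat !seq_sign_incr; last 2 first.
- by rewrite sorted_map; apply: sub_sorted (iota_ltn_sorted 0 k) => i j /=; lia.
- by rewrite sorted_map; apply: sub_sorted (iota_ltn_sorted 0 k) => i j /=; lia.
rewrite !mul1r /cross_sign big_map iota_index big_mkord.
(* The even number 2i is followed by exactly i smaller odd numbers, the 2j + 1 with j < i. *)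
rewrite (eq_bigr (fun i : 'I_k => (-1) ^+ i)) => [|i _].
  by rewrite prodrXr -(big_mkord xpredT id) -bin2_sum.
rewrite big_map big_mkord.
rewrite -[X in (-1) ^+ X]subn0 -(card_ord_interval 0 (ltnW (ltn_ord i))) -prodr_const.
rewrite [RHS]big_mkcond; apply: eq_bigr => j _; rewrite inE /=.
by case: ltnP => ?; [rewrite pair_sign_gt | rewrite pair_sign_lt] => //; lia.
Qed.

Definition quotient_beads (l : nat) (us : seq nat) : seq nat :=
  [seq (l + u)%N | u <- rev us] ++ [seq (l.-1 - u)%N | u <- us].

Lemma sorted_quotient_beads l us :
  sorted ltn us -> {in us, forall u, u < l}%N -> sorted gtn (quotient_beads l us).
Proof.
move=> lt_us us_l; rewrite sorted_pairwise; last exact: gtn_trans.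
rewrite pairwise_cat -!sorted_pairwise; try exact: gtn_trans.
apply/and3P; split.
- apply/allrelP => _ _ /mapP[a _ ->] /mapP[b b_us ->] /=.
  by have := us_l _ b_us; lia.
- rewrite sorted_map; have : sorted gtn (rev us) by rewrite rev_sorted.
  by apply: sub_sorted => a b /=; rewrite ltn_add2l.
rewrite sorted_map; elim: us lt_us us_l => //= a us IHus lt_us us_l.
have lt_a := order_path_min ltn_trans lt_us.
rewrite path_sortedE; last by move=> b c d /= bc cd; apply: ltn_trans cd bc.
rewrite IHus ?(path_sorted lt_us) //; last by move=> u us_u; rewrite us_l // inE us_u orbT.
rewrite andbT; apply/allP => b b_us /=; have := us_l a (mem_head _ _); have := us_l b.
by rewrite inE b_us orbT => /(_ isT); have /allP/(_ _ b_us) := lt_a; lia.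
Qed.

Lemma sorted_val_enum l (U : {set 'I_l}) : sorted ltn [seq val u | u <- enum U].
Proof.
rewrite sorted_map /(enum U) /enum_mem; apply: sorted_filter.
  by move=> a b c /=; apply: ltn_trans.
by rewrite -enumT -sorted_map val_enum_ord iota_ltn_sorted.
Qed.

Section RectangleExpansion.
Variables (R : comNzRingType) (x : nat -> R) (N k l : nat).
Local Notation hs := (complete_diff x N).
Local Notation x2 := (fun i => x i ^+ 2).

(** The two sums are the halves c = l + u and c = l - 1 - u of the alternating sum over all c < 2l;
    these two values of c have opposite parity, whence the minus sign. *)
Lemma complete_antisymmetrization (a b : nat) : (0 < l)%N ->
  \sum_(u < l) (-1) ^+ u * hs (l + u) a * hs (l.-1 - u) b -
  \sum_(u < l) (-1) ^+ u * hs (l + u) b * hs (l.-1 - u) a =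
  (-1) ^+ (l + a) * (if (a + b <= (l + l).-1)%N
                     then alternating_square x N ((l + l).-1 - (a + b)) else 0).
Proof.
move=> l_gt0; rewrite exprD -mulrA -alternating_diff_sum.
have -> : (l + l).-1.+1 = (l + l)%N by rewrite prednK // addn_gt0 l_gt0.
rewrite big_split_ord /= addrC mulrDr; congr (_ + _); last first.
  rewrite [in RHS](reindex_inj rev_ord_inj) /= -sumrN mulr_sumr; apply: eq_bigr => u _.
  have -> : ((l + l).-1 - (l - u.+1) = l + u)%N by have := ltn_ord u; lia.
  have -> : (l.-1 - u = l - u.+1)%N by have := ltn_ord u; lia.
  rewrite !mulrA -exprD (signr_odd_eq _ (_ : odd (l + (l - u.+1)) = odd u.+1)).
    by rewrite exprS; ring.
  by have := ltn_ord u; lia.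
rewrite mulr_sumr; apply: eq_bigr => u _.
have -> : ((l + l).-1 - (l + u) = l.-1 - u)%N by have := ltn_ord u; lia.
rewrite !mulrA -exprD (signr_odd_eq _ (_ : odd (l + (l + u)) = odd u)) //.
by rewrite addnA oddD addnn odd_double.
Qed.

Definition upper_factor : 'M[R]_(l, k + k) :=
  \matrix_(u, q) ((-1) ^+ u * hs (l + u) (nth 0%N (evens_odds k) q)).

Definition lower_factor : 'M[R]_(l, k + k) :=
  \matrix_(u, q) hs (l.-1 - u) (nth 0%N (evens_odds k) q).

(** The coefficient of omega at the positions 2i and 2j + 1: half of 2l - 1 - (2i + 2j + 1) is l - 1
    - j - i. *)
Definition square_block : 'M[R]_k :=
  \matrix_(i, j) ((-1) ^+ l * complete_diff x2 N (l.-1 - j) i).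

(** [B] is symmetric as soon as the product and the block have the same difference with their
    transposes; for the product, [complete_antisymmetrization] computes it. *)
Lemma upper_lower_sym : (0 < l)%N -> (k <= l)%N ->
  let B := upper_factor^T *m lower_factor - block_mx 0 square_block 0 0 in B^T = B.
Proof.
move=> l_gt0 le_kl B; apply/matrixP => p q; rewrite mxE.
have BE p' q' : B p' q' = \sum_(u < l) (-1) ^+ u * hs (l + u) (nth 0%N (evens_odds k) p') *
    hs (l.-1 - u) (nth 0%N (evens_odds k) q') - (block_mx 0 square_block 0 0 : 'M_(k + k)) p' q'.
  by rewrite !mxE; congr (_ - _); apply: eq_bigr => u _; rewrite !mxE.
have subE (a b c d : R) : b - a = d - c -> a - c = b - d.
  by move=> eq_ab; rewrite -[b](subrK a) eq_ab; ring.
rewrite !BE; apply: subE; rewrite complete_antisymmetrization // alternating_squareE.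
have D_E (i j : 'I_k) : (-1) ^+ l * (if (i.*2 + j.*2.+1 <= (l + l).-1)%N then
      if odd ((l + l).-1 - (i.*2 + j.*2.+1)) then 0 else
        complete_sym x2 N ((l + l).-1 - (i.*2 + j.*2.+1))./2 else 0) = square_block i j.
  rewrite mxE /complete_diff; congr (_ * _); have lt_jk := ltn_ord j.
  have -> : (i.*2 + j.*2.+1 <= (l + l).-1)%N = (i <= l.-1 - j)%N by lia.
  case: leqP => // le_i; rewrite ifF; last by lia.
  by congr complete_sym; lia.
have signD a b : (-1) ^+ (a + b.*2) = (-1) ^+ a :> R.
  by apply: signr_odd_eq; rewrite oddD odd_double addbF.
(* Positions of equal parity leave an odd index 2l - 1 - p - q, where [alternating_square] is 0. The
   mixed cases give the block and minus its transpose. *)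
case: (split_ordP p) => i ->; case: (split_ordP q) => j ->.
- rewrite !nth_evens !block_mxEul !mxE subrr; case: ifP => le_ij; last by rewrite mulr0.
  by rewrite ifT ?mulr0 //; lia.
- by rewrite nth_evens nth_odds block_mxEur block_mxEdl -D_E [X in _ - X]mxE subr0 signD.
- rewrite nth_evens nth_odds block_mxEur block_mxEdl -D_E [X in _ = X - _]mxE sub0r addnS exprS mulN1r signD.
  by rewrite addSn addnS -[(i.*2 + _)%N]addnC mulNr.
- rewrite !nth_odds !block_mxEdr !mxE subrr; case: ifP => le_ij; last by rewrite mulr0.
  by rewrite ifT ?mulr0 //; lia.
Qed.
Lemma pair_det_quotient_beads (f : 'I_k -> 'I_l) (us : seq nat) :
    size us = k -> (forall i : 'I_k, nth 0%N us i = f i) ->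
  pair_det upper_factor lower_factor f = (-1) ^+ (\sum_(u <- us) u) *
    \det (\matrix_(i < k + k, j < k + k)
      hs (nth 0%N ([seq (l + u)%N | u <- us] ++ [seq (l.-1 - u)%N | u <- us]) i)
         (nth 0%N (evens_odds k) j)).
Proof.
move=> size_us us_f.
pose d : 'rV[R]_(k + k) := \row_q (if split q is inl i then (-1) ^+ (f i) else 1).
have -> : (-1) ^+ (\sum_(u <- us) u) = \det (diag_mx d).
  rewrite det_diag big_split_ord /= [X in _ * X]big1 ?mulr1 => [|i _]; last first.
    by rewrite mxE -[rshift k i]/(unsplit (inr i)) unsplitK.
  rewrite (big_nth 0%N) size_us big_mkord -prodrXr; apply: eq_bigr => i _.
  by rewrite mxE -[lshift k i]/(unsplit (inl i)) unsplitK us_f.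
rewrite -det_mulmx mul_diag_mx; congr (\det _); apply/matrixP => p q; rewrite mxE [RHS]mxE !mxE.
case: (split_ordP p) => i -> /=.
  by rewrite nth_cat size_map size_us ltn_ord (nth_map 0%N) ?size_us // us_f !mxE.
rewrite nth_cat size_map size_us ltnNge leq_addr /= addKn mul1r.
by rewrite (nth_map 0%N) ?size_us // us_f !mxE.
Qed.

(** Inversions: k^2 + 'C(k, 2) in the rows, 'C(2k, 2) in the beads, 'C(k, 2) in [evens_odds] and
    'C(2k, 2) in the reversed columns. Modulo 2 only k^2, that is k, survives. *)
Lemma det_quotient_beads (us : seq nat) :
    size us = k -> sorted ltn us -> {in us, forall u, u < l}%N ->
  \det (\matrix_(i < k + k, j < k + k)
      hs (nth 0%N ([seq (l + u)%N | u <- us] ++ [seq (l.-1 - u)%N | u <- us]) i)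
         (nth 0%N (evens_odds k) j)) =
  (-1) ^+ k * \det (\matrix_(i < k + k, j < k + k)
      hs (nth 0%N (quotient_beads l us) i) (k + k - j.+1)).
Proof.
move=> size_us lt_us us_l.
set rows := [seq _ | u <- us] ++ _; pose beads := quotient_beads l us.
pose cols := rev (iota 0 (k + k)).
have sorted_beads := sorted_quotient_beads lt_us us_l.
have uniq_beads : uniq beads.
  by apply: sorted_uniq sorted_beads; [apply: gtn_trans | move=> a; apply: ltnn].
have size_rows : size rows = (k + k)%N by rewrite size_cat !size_map size_us.
have perm_rows : perm_eq rows beads by rewrite perm_cat2r perm_map // perm_sym perm_rev.
have uniq_rows : uniq rows by rewrite (perm_uniq perm_rows).
have perm_cols : perm_eq (evens_odds k) cols by rewrite (perm_trans (perm_evens_odds k)) // perm_sym perm_rev.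
rewrite (det_nth_perm (fun a j => hs a (nth 0%N (evens_odds k) j)) size_rows perm_rows uniq_rows).
rewrite -[\det (\matrix_(i < k + k, j < k + k) hs (nth _ beads i) _)]det_tr.
have -> : (\matrix_(i < k + k, j < k + k) hs (nth 0%N beads i) (nth 0%N (evens_odds k) j))^T =
    \matrix_(j < k + k, i < k + k) hs (nth 0%N beads i) (nth 0%N (evens_odds k) j).
  by apply/matrixP => i j; rewrite !mxE.
rewrite (det_nth_perm (fun b i => hs (nth 0%N beads i) b) (size_evens_odds k) perm_cols (uniq_evens_odds k)).
rewrite mulrA -rmorphM /=; congr (_ * _); last first.
  rewrite -det_tr; congr (\det _); apply/matrixP => i j; rewrite !mxE nth_rev ?size_iota //.
  by rewrite nth_iota ?add0n //; have := ltn_ord j; lia.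
have size_beads : size beads = (k + k)%N by rewrite -(perm_size perm_rows).
have sign_cols : seq_sign cols = (-1) ^+ 'C(k + k, 2).
  by rewrite seq_sign_decr ?size_rev ?size_iota // rev_sorted iota_ltn_sorted.
have sign_rows : seq_sign rows = (-1) ^+ (k * k + 'C(k, 2)).
  have sorted_low : sorted gtn [seq (l.-1 - u)%N | u <- us].
    by move: sorted_beads => /cat_sorted2[].
  rewrite seq_sign_cat (seq_sign_decr sorted_low) cross_sign_gt => [|_ _ /mapP[a _ ->] /mapP[b b_us ->]]; last first.
    by have := us_l _ b_us; lia.
  rewrite seq_sign_incr ?mul1r ?size_map ?size_us 1?addnC ?exprD //.
  by rewrite sorted_map; apply: sub_sorted lt_us => a b /=; rewrite ltn_add2l.
rewrite sign_rows (seq_sign_decr sorted_beads) -/beads size_beads seq_sign_evens_odds sign_cols.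
rewrite -!exprD rmorphXn rmorphN1; apply: signr_odd_eq.
by rewrite !oddD oddM andbb; case: (odd k); do 2!case: (odd 'C(_, _)).
Qed.

(** Since l - 1 - j = m + (k - 1 - j), reversing the columns gives (-1)^l times the Jacobi-Trudi
    matrix. *)
Lemma det_square_block m : l = (k + m)%N ->
  \det square_block = (-1) ^+ (l * k + 'C(k, 2)) * \det (jacobi_trudi x2 k N (fun=> m)).
Proof.
move=> def_l; pose cols := [seq (m + j)%N | j <- iota 0 k].
have sorted_cols : sorted ltn cols.
  by rewrite sorted_map; apply: sub_sorted (iota_ltn_sorted 0 k) => i j /=; rewrite ltn_add2l.
have perm_cols : perm_eq (rev cols) cols by rewrite perm_rev.
have size_cols : size cols = k by rewrite size_map size_iota.
have -> : square_block = (-1) ^+ l *: (\matrix_(i < k, j < k) complete_diff x2 N (nth 0%N (rev cols) i) j)^T.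
  apply/matrixP => i j; rewrite !mxE; congr (_ * complete_diff _ _ _ _).
  rewrite nth_rev size_cols // (nth_map 0%N) ?size_iota ?nth_iota; have := ltn_ord j; lia.
rewrite detZ det_tr (det_nth_perm (fun a i => complete_diff x2 N a i) _ perm_cols) ?size_rev //; last first.
  by rewrite rev_uniq (sorted_uniq ltn_trans ltnn).
rewrite mulrA -exprM exprD; congr (_ * _ * _).
  rewrite (seq_sign_incr sorted_cols) mulr1 seq_sign_decr ?rev_sorted // size_rev size_cols.
  by rewrite rmorphXn rmorphN1.
rewrite -det_tr; congr (\det _); apply/matrixP => i j; rewrite !mxE.
by rewrite (nth_map 0%N) ?size_iota ?nth_iota.
Qed.
End RectangleExpansion.

(** The exponent gathers l k + 'C(k, 2) from the block, k from the reorderings and the sum of U from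
    omega; modulo 2, l k + k is k m. *)
Lemma sum_quotient_beads (R : idomainType) (x : nat -> R) (N k m l : nat) :
    (0 < l)%N -> l = (k + m)%N -> (k`!)%:R != 0 :> R ->
  \sum_(U : {set 'I_l} | #|U| == k)
    (-1) ^+ (k * m + 'C(k, 2) + \sum_(u in U) u) *
    \det (\matrix_(i < k + k, j < k + k)
      complete_diff x N (nth 0%N (quotient_beads l [seq val u | u <- enum U]) i) (k + k - j.+1)) =
  \det (jacobi_trudi (fun i => x i ^+ 2) k N (fun=> m)).
Proof.
move=> l_gt0 def_l fact_neq0; have le_kl : (k <= l)%N by lia.
have := sum_pair_det_subsets (Ordinal l_gt0) fact_neq0 (upper_lower_sym x N l_gt0 le_kl).
rewrite (det_square_block x N def_l) => /(congr1 ( *%R ((-1) ^+ (l * k + 'C(k, 2))))).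
rewrite mulrA -expr2 sqrr_sign mul1r => <-; rewrite mulr_sumr; apply: eq_bigr => U /eqP cardU.
pose us := [seq val u | u <- enum U].
have size_us : size us = k by rewrite size_map -cardE.
rewrite (pair_det_quotient_beads x N size_us) => [|i]; last first.
  by rewrite (nth_map (Ordinal l_gt0)) // -cardE cardU.
rewrite det_quotient_beads //; first last.
- by move=> _ /mapP[u _ ->]; exact: ltn_ord.
- exact: sorted_val_enum.
rewrite /= big_map big_enum /= !mulrA -!exprD; congr (_ * _); apply: signr_odd_eq.
have odd_l : odd l = odd k (+) odd m by rewrite {1}def_l oddD.
rewrite !oddD !oddM odd_l; move: (odd (\sum_(u in U) u)) (odd 'C(k, 2)) => b c.
by case: (odd k); case: (odd m); case: b; case: c.
Qed.

(** * Beta numbers *)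

Lemma sorted_gtn_nth (s : seq nat) i : sorted gtn s -> (i.+1 < size s)%N ->
  (nth 0 s i.+1 < nth 0 s i)%N.
Proof. by move=> /(sortedP 0%N) gt_s /gt_s. Qed.

Lemma sorted_gtn_size (s : seq nat) i : sorted gtn s -> (i < size s)%N ->
  (size s <= nth 0 s i + i.+1)%N.
Proof.
move=> gt_s lt_i; have [n] := ubnP (size s - i); elim: n i lt_i => // n IHn i lt_i lt_n.
have [lt_i1|le_i1] := ltnP i.+1 (size s); last by lia.
by have := IHn _ lt_i1; have := sorted_gtn_nth gt_s lt_i1; lia.
Qed.

Lemma schur_beads (xi : seq nat) n : sorted gtn xi ->
  schur (mkseq (fun i => nth 0 xi i - (size xi - i.+1))%N (size xi)) n =
  \det (\matrix_(i < size xi, j < size xi)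
    complete_diff (mpoly_var n) n (nth 0%N xi i) (size xi - j.+1)).
Proof.
move=> gt_xi; rewrite schur_jacobi_trudi; last first.
  apply/(sortedP 0%N) => i; rewrite size_mkseq => lt_i.
  rewrite !nth_mkseq //; last exact: ltnW.
  by have := sorted_gtn_nth gt_xi lt_i; rewrite /=; lia.
rewrite size_mkseq; congr (\det _); apply/matrixP => i j; rewrite !mxE nth_mkseq //.
have shift A S I J : (I < S)%N -> (J < S)%N -> (S <= A + I.+1)%N ->
    (A - (S - I.+1) + J + (S - J.+1) = A + I)%N by lia.
(* Both sides are raised, by size xi - 1 - j and by i, to the common first argument xi_i + i, where
   no truncated difference remains. *)
rewrite -[LHS](complete_diff_add _ _ _ _ (size xi - j.+1)) -[RHS](complete_diff_add _ _ _ _ i).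
by rewrite shift ?ltn_ord ?(sorted_gtn_size gt_xi) ?ltn_ord // [X in complete_diff _ _ _ X = _]addnC.
Qed.

(* Trailing zero parts of a partition shift its beta numbers by t. *)
Lemma det_low_beads (R : comNzRingType) (x : nat -> R) N (bs : seq nat) r t : size bs = r ->
  \det (\matrix_(i < r + t, j < r + t) complete_diff x N
     (nth 0%N ([seq (t + b)%N | b <- bs] ++ rev (iota 0 t)) i) (r + t - j.+1)) =
  \det (\matrix_(i < r, j < r) complete_diff x N (nth 0%N bs i) (r - j.+1)).
Proof.
move=> size_bs; set A := (X in \det X = _).
have low_nth (i : 'I_t) : nth 0%N ([seq (t + b)%N | b <- bs] ++ rev (iota 0 t)) (r + i) = (t - i.+1)%N.
  rewrite nth_cat size_map size_bs ltnNge leq_addr /= addKn nth_rev size_iota //.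
  by rewrite nth_iota //; have := ltn_ord i; lia.
(* The last t rows vanish in the first r columns, and the lower right block, with entries h_(j - i),
   is unitriangular. *)
rewrite -[A]submxK.
have -> : dlsubmx A = 0.
  apply/matrixP => i j; rewrite !mxE low_nth /= /complete_diff ifF //.
  by have := ltn_ord i; have := ltn_ord j; lia.
rewrite det_ublock [X in _ * X](_ : _ = 1) ?mulr1.
  congr (\det _); apply/matrixP => i j; rewrite !mxE /= nth_cat size_map size_bs ltn_ord.
  rewrite (nth_map 0%N) ?size_bs // -[RHS](complete_diff_add _ _ _ _ t).
  by congr complete_diff; have := ltn_ord j; lia.
rewrite -det_tr det_trig; last first.
  apply/is_trig_mxP => i j lt_ij; rewrite !mxE low_nth /= /complete_diff ifF //.
  by have := ltn_ord j; lia.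
rewrite big1 // => i _; rewrite !mxE low_nth /= /complete_diff.
by rewrite -addnS subnDl leqnn subnn complete_sym0.
Qed.

Lemma count_iota_initial (p : pred nat) d i :
    (forall j j', (j < j' < d)%N -> p j' -> p j) -> (i < d)%N ->
  p i = (i < count p (iota 0 d))%N.
Proof.
elim: d i => // d IHd i closed_p; rewrite ltnS.
have -> : iota 0 d.+1 = iota 0 d ++ [:: d] by rewrite -addn1 iotaD add0n.
rewrite count_cat /= addn0.
have closed_d j j' : (j < j' < d)%N -> p j' -> p j.
  by move=> /andP[lt_j lt_j']; apply: closed_p; rewrite lt_j ltnW.
have le_count : (count p (iota 0 d) <= d)%N by rewrite -[X in (_ <= X)%N](size_iota 0) count_size.
rewrite leq_eqVlt => /orP[/eqP->|lt_id].
  case pd: (p d); last by rewrite addn0; lia.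
  have /eqP -> : count p (iota 0 d) == d; last by rewrite addn1 leqnn.
  rewrite -[X in _ == X](size_iota 0) -all_count; apply/allP => j.
  by rewrite mem_iota => lt_j; apply: (closed_p _ d) => //; lia.
rewrite (IHd _ closed_d) //; case pd: (p d); last by rewrite addn0.
rewrite -(IHd _ closed_d) // (closed_p _ d) //; last by rewrite lt_id leqnn.
rewrite ltn_addr // -(IHd _ closed_d) //; apply: (closed_p _ d) => //; first by rewrite lt_id leqnn.
Qed.

Section FrobeniusBetaNumbers.
Variables a b : seq nat.
Hypotheses (gt_a : sorted gtn a) (gt_b : sorted gtn b) (size_ab : size a = size b).
Local Notation d := (size b).
Local Notation leg j := (count (fun i => j < nth 0 b i + i.+1)%N (iota 0 d)).

Let b_add_mono i j : (i <= j < d)%N -> (nth 0 b j + j <= nth 0 b i + i)%N.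
Proof.
move=> /andP[/subnK<-]; elim: (j - i)%N => // e IHe; rewrite addSn => lt_e.
apply: leq_trans (IHe (ltnW lt_e)); have := sorted_gtn_nth gt_b lt_e; lia.
Qed.

Let leg_bound j : (leg j <= d)%N.
Proof. by rewrite -[X in (_ <= X)%N](size_iota 0) count_size. Qed.

Let legP i j : (i < d)%N -> (i < leg j)%N = (j <= nth 0 b i + i)%N.
Proof.
move=> lt_id; rewrite -(count_iota_initial _ lt_id) ?addnS // => i1 i2 /andP[lt_i lt_i2].
by have := @b_add_mono i1 i2; rewrite ltnW // lt_i2 => /(_ isT); lia.
Qed.

(** The formula also covers rows past the last one: there j exceeds every b_i + i, as these decrease
    weakly from b_0, and the count is 0. *)
Lemma nth_frobenius j : nth 0%N (frobenius a b) j =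
  (if (j < d)%N then (nth 0 a j + j.+1)%N else leg j).
Proof.
rewrite /frobenius size_ab; case def_b: b => [|b1 b'] /=; first by rewrite nth_nil.
have size_d : d = (size b').+1 by rewrite def_b.
have b0 : nth 0%N b 0 = b1 by rewrite def_b.
have [lt_j|le_j] := ltnP j b1.+1; first by rewrite nth_mkseq.
rewrite nth_default ?size_mkseq //.
have := @sorted_gtn_size b 0 gt_b; rewrite b0 size_d => /(_ isT) le_b1.
rewrite ifF; last by apply/negbTE; rewrite -leqNgt; lia.
rewrite -[RHS]/(count (fun i => j < nth 0 (b1 :: b') i + i.+1)%N (iota 0 (size b').+1)).
apply/esym/eqP; rewrite -leqn0 leqNgt -has_count; apply/hasPn => i.
rewrite mem_iota => /andP[_ lt_i]; rewrite -leqNgt -def_b.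
by have := @b_add_mono 0 i; rewrite b0 size_d lt_i => /(_ isT); lia.
Qed.

Lemma frobenius_beta_sorted N :
  sorted gtn (mkseq (fun j => nth 0 (frobenius a b) j + (N - j.+1))%N N).
Proof.
apply/(sortedP 0%N) => j; rewrite size_mkseq => lt_j.
pose beta j := (nth 0 (frobenius a b) j + (N - j.+1))%N.
rewrite !(@nth_mkseq _ _ beta) //; last exact: ltnW.
rewrite /beta !nth_frobenius /=.
have [lt_j1d|le_dj1] := ltnP j.+1 d.
  by rewrite (ltnW lt_j1d); have := @sorted_gtn_nth a j gt_a; rewrite size_ab => /(_ lt_j1d); lia.
have := leg_bound j.+1; case: (ltnP j d) => [lt_jd|le_dj]; first by lia.
suff : (leg j.+1 <= leg j)%N by lia.
by apply: sub_count => i /=; apply: ltn_trans.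
Qed.

(** Arms are the beads N + a_i and legs are the gaps N - 1 - b_i. The proof counts: all beta numbers
    lie among these candidates, there are at most N candidates, and the N beta numbers are
    distinct. *)
Lemma mem_frobenius_beta N y : (forall i, i < d -> nth 0 b i < N)%N ->
  (y \in mkseq (fun j => nth 0 (frobenius a b) j + (N - j.+1))%N N) =
  (if (y < N)%N then (N.-1 - y)%N \notin b else (y - N)%N \in a).
Proof.
move=> lt_bN; set beta := mkseq _ _.
have le_dN : (d <= N)%N.
  case d_gt0: d => [//|d']; have := @sorted_gtn_size b 0 gt_b; have := lt_bN 0%N.
  by rewrite d_gt0; lia.
have uniq_b : uniq b by apply: sorted_uniq gt_b; [apply: gtn_trans | move=> v; apply: ltnn].
have b_ltN v : v \in b -> (v < N)%N by move=> /(nthP 0%N)[i lt_i <-]; apply: lt_bN.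
pose low := [seq y <- iota 0 N | (N.-1 - y)%N \notin b].
have sub : {subset beta <= [seq (N + v)%N | v <- a] ++ low}.
  move=> z /mapP[j]; rewrite mem_iota add0n => /andP[_ lt_jN] ->; rewrite nth_frobenius mem_cat.
  case: (ltnP j d) => [lt_jd|le_dj]; apply/orP; [left|right].
    by apply/mapP; exists (nth 0%N a j); [rewrite mem_nth ?size_ab | lia].
  have le_leg := leg_bound j; rewrite mem_filter mem_iota; apply/andP; split; last by lia.
  apply/negP => /(nthP 0%N)[i lt_id]; have := @legP i j lt_id; move: le_leg.
  by move: (leg j) (nth 0%N b i) => c v le_cd; case: (leqP j (v + i)); case: (ltnP i c) => //; lia.
have size_low : (size low <= N - d)%N.
  rewrite size_filter -[X in (_ <= X - _)%N](size_iota 0).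
  rewrite -(count_predC (fun y => (N.-1 - y)%N \notin b)) leq_subRL; last first.
    by rewrite count_predC size_iota.
  rewrite addnC leq_add2l -size_filter -(size_map (fun v => N.-1 - v)%N).
  apply: uniq_leq_size.
    by rewrite map_inj_in_uniq // => v w /b_ltN lt_v /b_ltN lt_w; lia.
  move=> z /mapP[v v_b ->]; rewrite mem_filter mem_iota /= negbK.
  have lt_v := b_ltN v v_b.
  by rewrite (_ : (N.-1 - (N.-1 - v))%N = v) ?v_b; lia.
have uniq_beta : uniq beta.
  by apply: sorted_uniq (frobenius_beta_sorted N); [apply: gtn_trans | move=> v; apply: ltnn].
have [|_ ->] := uniq_min_size uniq_beta sub.
  by rewrite size_cat size_map size_ab size_mkseq -[X in (_ <= X)%N](subnKC le_dN) leq_add2l.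
rewrite mem_cat mem_filter mem_iota leq0n add0n /=; case: ltnP => [lt_yN|le_Ny].
  rewrite andbT orbC; case: (_ \notin b) => //=; apply/negP => /mapP[v _]; lia.
rewrite andbF orbF; apply/mapP/idP => [[v a_v ->]|a_y]; first by rewrite addKn.
by exists (y - N)%N; rewrite ?subnKC.
Qed.

End FrobeniusBetaNumbers.

(** * The partitions obtained from Lambda *)

Section GrownPartitions.
Variable l : nat.
Implicit Types I : {set 'I_l}.

Definition set_values I : seq nat := [seq val u | u <- enum I].

Definition grown_part I (v : nat) : nat := (3 * v + 1 + (v \in set_values I))%N.

(** The index u runs against the rows: row i holds the part with u = l - 1 - i, so I is a set of
    values u and not of row numbers. *)
Definition grown I : seq nat := mkseq (fun i => grown_part I (l - i.+1)) l.

Lemma mem_set_values I (u : 'I_l) : (val u \in set_values I) = (u \in I).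
Proof. by rewrite mem_map ?mem_enum //; apply: val_inj. Qed.

Lemma set_values_lt I v : v \in set_values I -> (v < l)%N.
Proof. by move=> /mapP[u _ ->]; apply: ltn_ord. Qed.

Lemma mem_set_valuesC I v : (v \in set_values (~: I)) = (v < l)%N && (v \notin set_values I).
Proof.
have [lt_v|le_v] := ltnP v l.
  by rewrite -[v]/(val (Ordinal lt_v)) !mem_set_values inE.
by apply/negP => /set_values_lt; rewrite ltnNge le_v.
Qed.

Lemma size_grown I : size (grown I) = l.
Proof. exact: size_mkseq. Qed.

Lemma nth_grown I i : (i < l)%N -> nth 0%N (grown I) i = grown_part I (l - i.+1).
Proof. exact: nth_mkseq. Qed.

Lemma grown_part_lt I v w : (v < w)%N -> (grown_part I v < grown_part I w)%N.
Proof. by rewrite /grown_part; case: (v \in _); case: (w \in _); lia. Qed.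

Lemma sorted_grown I : sorted gtn (grown I).
Proof.
apply/(sortedP 0%N) => i; rewrite size_grown => lt_i.
by rewrite !nth_grown ?(ltnW lt_i) //=; apply: grown_part_lt; lia.
Qed.

Lemma mem_grown I v : reflect (exists2 u, (u < l)%N & v = grown_part I u) (v \in grown I).
Proof.
apply: (iffP mapP) => [[i]|[u lt_u ->]].
  rewrite mem_iota => lt_i ->; exists (l - i.+1)%N => //; lia.
exists (l - u.+1)%N; first by rewrite mem_iota; lia.
by congr grown_part; lia.
Qed.

Lemma mem_grown_upper I w : ((3 * w).+1 \in grown I) = (w \in set_values (~: I)).
Proof.
rewrite mem_set_valuesC; apply/mem_grown/andP => [[u lt_u]|[lt_w w_I]].
  rewrite /grown_part => def_w; have [u_I def_u] : u \notin set_values I /\ u = w.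
    by move: def_w; case: (u \in _) => /= ?; lia.
  by rewrite -def_u.
by exists w; rewrite // /grown_part (negbTE w_I); lia.
Qed.

Lemma mem_grown_lower I w :
  ((3 * w).+1 \in [seq v.-1 | v <- grown I]) = (w \in set_values I).
Proof.
apply/mapP/idP => [[v /mem_grown[u lt_u ->]]|w_I].
  rewrite /grown_part => def_w; have [u_I def_u] : u \in set_values I /\ u = w.
    by move: def_w; case: (u \in _) => /= ?; lia.
  by rewrite -def_u.
exists (grown_part I w); last by rewrite /grown_part w_I; lia.
by apply/mem_grown; exists w => //; apply: set_values_lt w_I.
Qed.

(** Put N = 3 * size D, where D is the double. A bead 3w + 1 above N is N plus an ungrown part, and
    a gap 3w + 1 below N is N minus a grown part. So each u outside I yields w = size D + u and w =
    size D - 1 - u, while all w < size D - l are beads, standing for zero parts. *)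
Lemma double_grown_beads I : (0 < l)%N ->
  let beta := beta_numbers 3 (double_partition (grown I)) in
  [seq ((x - 1) %/ 3)%N | x <- beta & (x %% 3 == 1)%N] =
  [seq (size (double_partition (grown I)) - l + b)%N | b <- quotient_beads l (set_values (~: I))]
    ++ rev (iota 0 (size (double_partition (grown I)) - l)).
Proof.
move=> l_gt0 beta; set D := double_partition _; set t := (size D - l)%N.
pose preds := [seq v.-1 | v <- grown I].
have nth_preds i : (i < l)%N -> nth 0%N preds i = (grown_part I (l - i.+1)).-1.
  by move=> lt_i; rewrite (nth_map 0%N) ?size_grown // nth_grown.
have gt_preds : sorted gtn preds.
  apply/(sortedP 0%N) => i; rewrite size_map size_grown => lt_i.
  rewrite !nth_preds ?(ltnW lt_i) //=.
  have := @grown_part_lt I (l - i.+2) (l - i.+1).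
  have : (0 < grown_part I (l - i.+2))%N by rewrite /grown_part addnAC addn1.
  by lia.
have size_gp : size (grown I) = size preds by rewrite [RHS]size_map.
have nth0 : nth 0%N preds 0 = (grown_part I l.-1).-1.
  by rewrite nth_preds // subn1.
have size_D : size D = (grown_part I l.-1).-1.+1.
  rewrite -nth0 /D /double_partition /frobenius size_mkseq -/preds.
  by case def_p: preds => //; have := size_gp; rewrite size_grown def_p /=; lia.
have le_lD : (l <= size D)%N by rewrite size_D /grown_part; lia.
have lt_preds i : (i < size preds -> nth 0 preds i < 3 * size D)%N.
  move=> lt_i; have lt_il : (i < l)%N by rewrite -(size_grown I) size_gp.
  rewrite nth_preds // size_D /grown_part.
  by case: (_ \in _); case: (_ \in _); lia.
have betaE : beta = mkseq (fun j => nth 0 (frobenius (grown I) preds) j + (3 * size D - j.+1))%N (3 * size D).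
  by [].
have gt_beta : sorted gtn beta.
  rewrite betaE; apply: frobenius_beta_sorted => //; exact: sorted_grown.
have mem_beta y : (y \in beta) = (if (y < 3 * size D)%N then ((3 * size D).-1 - y)%N \notin preds
    else (y - 3 * size D)%N \in grown I).
  by rewrite betaE mem_frobenius_beta //; exact: sorted_grown.
(* Both lists are strictly decreasing, so it suffices to compare their members. *)
apply: (irr_sorted_eq gtn_trans); first by move=> v; apply: ltnn.
- apply: (homo_sorted_in (P := [pred x | x %% 3 == 1]%N) (e := gtn)).
  + by move=> x y /=; rewrite !inE /=; lia.
  + exact: filter_all.
  by apply: (sorted_filter gtn_trans).
- rewrite sorted_pairwise; last exact: gtn_trans.
  rewrite pairwise_cat -!sorted_pairwise; try exact: gtn_trans.
  apply/and3P; split.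
  + apply/allrelP => _ w /mapP[b _ ->]; rewrite mem_rev mem_iota /=; lia.
  + rewrite sorted_map; have lt_U v : v \in set_values (~: I) -> (v < l)%N by apply: set_values_lt.
    apply: sub_sorted (sorted_quotient_beads (sorted_val_enum _) lt_U) => v w /=; lia.
  by rewrite rev_sorted iota_ltn_sorted.
move=> w; transitivity ((3 * w).+1 \in beta).
  apply/mapP/idP => [[x]|w_beta].
    rewrite mem_filter => /andP[x1 x_beta] ->; rewrite (_ : (3 * ((x - 1) %/ 3)).+1 = x)%N //; lia.
  by exists (3 * w).+1; [rewrite mem_filter w_beta andbT; lia | lia].
rewrite mem_beta mem_cat mem_rev mem_iota leq0n add0n /=.
case: ltnP => [lt_w|le_w].
  rewrite (_ : (3 * size D).-1 - (3 * w).+1 = (3 * (size D - w.+1)).+1)%N; last by lia.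
  rewrite mem_grown_lower; have [lt_wt|le_tw] := ltnP w t.
    rewrite orbT; apply/negP => /set_values_lt; lia.
  rewrite orbF; have lt_v : (size D - w.+1 < l)%N by lia.
  have <- : ((size D - w.+1)%N \in set_values (~: I)) = ((size D - w.+1)%N \notin set_values I).
    by rewrite mem_set_valuesC lt_v.
  apply/idP/mapP => [v_U|[b]].
    exists (l.-1 - (size D - w.+1))%N; last by lia.
    by rewrite mem_cat; apply/orP; right; apply/mapP; exists (size D - w.+1)%N.
  rewrite mem_cat => /orP[] /mapP[u]; first by move=> _ -> def_w; lia.
  move=> u_U -> def_w; have lt_u := set_values_lt u_U.
  by rewrite (_ : (size D - w.+1)%N = u) //; lia.
rewrite (_ : ((3 * w).+1 - 3 * size D = (3 * (w - size D)).+1)%N); last by lia.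
rewrite mem_grown_upper [(w < t)%N]ltnNge (_ : t <= w)%N ?orbF; last by lia.
apply/idP/mapP => [w_U|[b]].
  exists (l + (w - size D))%N; last by lia.
  by rewrite mem_cat map_f // mem_rev.
rewrite mem_cat => /orP[] /mapP[u].
  by rewrite mem_rev => u_U -> def_w; rewrite (_ : (w - size D)%N = u) //; lia.
by move=> u_U -> def_w; have := set_values_lt u_U; lia.
Qed.

Lemma schur_bar_quotient1_grown I k n : (0 < l)%N -> #|~: I| = k ->
  schur (bar_quotient1 (grown I)) n =
  \det (\matrix_(i < k + k, j < k + k) complete_diff (mpoly_var n) n
    (nth 0%N (quotient_beads l (set_values (~: I))) i) (k + k - j.+1)).
Proof.
move=> l_gt0 card_U; rewrite /bar_quotient1 /quotient_component double_grown_beads //.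
set xi := _ ++ _; set t := (_ - l)%N in xi *.
have size_U : size (quotient_beads l (set_values (~: I))) = (k + k)%N.
  by rewrite size_cat !size_map size_rev size_map -cardE card_U.
have size_xi : size xi = (k + k + t)%N by rewrite size_cat size_map size_rev size_iota size_U.
have gt_xi : sorted gtn xi.
  rewrite sorted_pairwise; last exact: gtn_trans.
  rewrite pairwise_cat -!sorted_pairwise; try exact: gtn_trans.
  apply/and3P; split.
  + apply/allrelP => _ w /mapP[b _ ->]; rewrite mem_rev mem_iota /=; lia.
  + rewrite sorted_map; have lt_U v : v \in set_values (~: I) -> (v < l)%N by apply: set_values_lt.
    apply: sub_sorted (sorted_quotient_beads (sorted_val_enum _) lt_U) => v w /=; lia.
  by rewrite rev_sorted iota_ltn_sorted.
by rewrite (schur_beads n gt_xi) size_xi (det_low_beads _ _ _ size_U).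
Qed.

End GrownPartitions.

(** * The 3-bar sign *)

(** The natural order is increasing and has sign 1, and [bar_perm] relates it to [bar_order]. *)
Lemma bar_sign_seq_sign (mu : seq nat) : uniq mu -> bar_sign mu = seq_sign (bar_order mu).
Proof.
move=> uniq_mu; have perm_nat : perm_eq (natural_order mu) mu by rewrite perm_sort.
have size_nat := perm_size perm_nat; have size_bar := perm_size (perm_bar_order mu).
have nat_bar (i : 'I_(size mu)) :
    nth 0%N (natural_order mu) i = nth 0%N (bar_order mu) (bar_perm mu i).
  rewrite bar_permE // nth_index // (perm_mem (perm_bar_order mu)) -(perm_mem perm_nat).
  by rewrite mem_nth ?size_nat.
have := seq_sign_perm size_nat size_bar nat_bar.
rewrite seq_sign_incr => [sgn_eq|]; last first.
  rewrite ltn_sorted_uniq_leq (perm_uniq perm_nat) uniq_mu.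
  exact: sort_sorted leq_total _.
rewrite /bar_sign; apply: (@mulrI _ ((-1) ^+ bar_perm mu)); last by rewrite -expr2 sqrr_sign.
by rewrite unitrX // unitrN1.
Qed.

Lemma seq_sign_map (f : nat -> nat) (s : seq nat) :
  {homo f : a b / (a < b)%N} -> seq_sign (map f s) = seq_sign s.
Proof.
move=> f_mono; elim: s => //= a s ->; congr (_ * _); rewrite big_map; apply: eq_bigr => b _.
case: (ltngtP a b) => [lt_ab|lt_ba|->]; last by rewrite /pair_sign !subrr.
  by rewrite !pair_sign_lt ?f_mono.
by rewrite !pair_sign_gt ?f_mono.
Qed.

Lemma prod_pair_signC (a : nat) (s : seq nat) :
  \prod_(b <- s) pair_sign b a = (-1) ^+ size s * \prod_(b <- s) pair_sign a b.
Proof.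
elim: s => [|b s IHs]; first by rewrite !big_nil mulr1.
by rewrite !big_cons IHs pair_signC /= exprS; ring.
Qed.

(* Reordering t ++ s into the pairs t_1 s_1 t_2 s_2 ..., with s and t of sizes k
   and m, moves s_j past the m - j last elements of t. *)
Definition interleave_exponent (k m : nat) : nat := \sum_(j < minn k m) (m - j.+1).

Lemma interleave_exponentSS k m :
  interleave_exponent k.+1 m.+1 = (m + interleave_exponent k m)%N.
Proof.
by rewrite /interleave_exponent minnSS big_ord_recl subn1.
Qed.

(** Putting the head of s in front of the tail of t crosses every element of that tail: this is the
    first summand of the exponent. *)
Lemma seq_sign_interleave (s t : seq nat) : let p := minn (size s) (size t) in
  seq_sign (flatten [seq [:: q.2; q.1] | q <- zip s t] ++ (drop p s ++ drop p t)) =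
  (-1) ^+ interleave_exponent (size s) (size t) * seq_sign (t ++ s).
Proof.
elim: s t => [|a s IHs] [|b t] /=.
- by rewrite /interleave_exponent big_ord0 mul1r.
- by rewrite /interleave_exponent ?min0n big_ord0 mul1r cats0.
- by rewrite /interleave_exponent ?minn0 big_ord0 mul1r ?cats0.
rewrite minnSS interleave_exponentSS /= IHs !(perm_big _ (Defs.perm_zip_drop s t)) /=.
rewrite big_cons (perm_big _ (Defs.perm_zip_drop s t)) /=.
rewrite !seq_sign_cat /= /cross_sign !big_cat /= big_cons.
have -> : \prod_(c <- t) \prod_(d <- a :: s) pair_sign c d =
    (-1) ^+ size t * \prod_(c <- t) pair_sign a c * \prod_(c <- t) \prod_(d <- s) pair_sign c d.
  by rewrite -prod_pair_signC -big_split /=; apply: eq_bigr => c _; rewrite big_cons.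
have sq : (-1) ^+ size t * (-1) ^+ size t = 1%R :> int by rewrite -expr2 sqrr_sign.
rewrite exprD; set A := (-1) ^+ size t in sq *.
rewrite -[LHS]mul1r -sq.
by ring.
Qed.

(** The two cases of [epsilon] tell which runner is exhausted first: for m <= k the summands are m -
    1, ..., 0, and otherwise they add up to k m - 'C(k + 1, 2). *)
Lemma sign_interleave_exponent k m : 
  (-1) ^+ interleave_exponent k m = epsilon (k + m) m :> int.
Proof.
rewrite /epsilon /interleave_exponent -addnn leq_add2r; case: leqP => [le_mk|lt_km].
  rewrite (reindex_inj rev_ord_inj) /=.
  rewrite (eq_bigr (fun j : 'I_m => nat_of_ord j)) => [|j _]; last by have := ltn_ord j; lia.
  by rewrite -(big_mkord xpredT id) -bin2_sum.
rewrite addnK; apply: signr_odd_eq.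
have -> : 'C(k.+1, 2) = \sum_(j < k) j.+1.
  by rewrite -bin2_sum big_mkord big_ord_recl add0n.
have : (\sum_(j < k) (m - j.+1) + \sum_(j < k) j.+1 = k * m)%N.
  rewrite -big_split /= (eq_bigr (fun=> m)) => [|j _]; last by have := ltn_ord j; lia.
  by rewrite sum_nat_const card_ord.
move: (\sum_(j < k) (m - j.+1))%N (\sum_(j < k) j.+1)%N => a b <-; rewrite !oddD; case: (odd b); case: (odd a) => //.
Qed.

Lemma count_gt_sum (s : seq nat) : sorted ltn s ->
  \sum_(u <- s) count (fun v => u < v)%N s = 'C(size s, 2).
Proof.
elim: s => [|a s IHs] /=; first by rewrite big_nil.
move=> lt_s; have /allP lt_a := order_path_min ltn_trans lt_s.
rewrite big_cons ltnn add0n binS bin1 -(IHs (path_sorted lt_s)) addnC.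
have -> : count (fun v => a < v)%N s = size s by apply/eqP; rewrite -all_count; apply/allP.
congr (_ + _)%N; rewrite big_seq [RHS]big_seq; apply: eq_bigr => u u_s.
by have /= lt_au := lt_a _ u_s; rewrite ltnNge (ltnW lt_au).
Qed.

Lemma prod_pair_sign_count (u : nat) (s : seq nat) : u \notin s ->
  \prod_(a <- s) pair_sign a u = (-1) ^+ count (fun v => u < v)%N s.
Proof.
elim: s => [|a s IHs]; first by rewrite big_nil.
rewrite inE negb_or big_cons /= exprD => /andP[neq_ua /IHs->]; congr (_ * _).
by case: ltngtP neq_ua => // lt_ua _; [rewrite pair_sign_gt | rewrite pair_sign_lt].
Qed.

(** For u outside I, the larger elements of I number l - 1 - u minus the larger elements of the
    complement. Summed over the k such u this is k (l - 1) - sum u - 'C(k, 2). *)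
Lemma seq_sign_complement l (I : {set 'I_l}) : 
  seq_sign (set_values I ++ set_values (~: I)) =
  (-1) ^+ (#|~: I| * #|I| + 'C(#|~: I|, 2) + \sum_(u in ~: I) u).
Proof.
have size_U (U : {set 'I_l}) : size (set_values U) = #|U| by rewrite size_map -cardE.
rewrite seq_sign_cat !seq_sign_incr ?sorted_val_enum // !mul1r /cross_sign exchange_big /=.
rewrite big_seq (eq_bigr (fun u => (-1) ^+ count (fun v => u < v)%N (set_values I))) => [|u u_U]; last first.
  by rewrite prod_pair_sign_count //; move: u_U; rewrite mem_set_valuesC => /andP[].
rewrite -big_seq prodrXr; apply: signr_odd_eq.
have countE u : u \in set_values (~: I) ->
    (count (fun v => u < v) (set_values I) + count (fun v => u < v) (set_values (~: I)) + u = l.-1)%N.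
  move=> u_U; have lt_u := set_values_lt u_U.
  have perm_all : perm_eq (set_values I ++ set_values (~: I)) (iota 0 l).
    rewrite uniq_perm ?iota_uniq // => [|v].
      rewrite cat_uniq !(sorted_uniq ltn_trans ltnn) ?sorted_val_enum //= andbT.
      by apply/hasPn => v; rewrite mem_set_valuesC => /andP[].
    rewrite mem_cat mem_set_valuesC mem_iota add0n /=.
    by have := @set_values_lt _ I v; case: (v \in _); case: (v < l)%N => //= ->.
  rewrite -count_cat (seq.permP perm_all) -(subnKC lt_u) iotaD count_cat.
  have -> : count (fun v => u < v)%N (iota 0 u.+1) = 0%N.
    apply/eqP; rewrite -leqn0 leqNgt -has_count; apply/hasPn => v.
    by rewrite mem_iota -leqNgt.
  have -> : count (fun v => u < v)%N (iota (0 + u.+1) (l - u.+1)) = (l - u.+1)%N.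
    rewrite -[RHS](size_iota (0 + u.+1)); apply/eqP; rewrite -all_count; apply/allP => v.
    by rewrite mem_iota => /andP[].
  by lia.
have total : (\sum_(u <- set_values (~: I)) count (fun v => u < v)%N (set_values I) +
    'C(#|~: I|, 2) + \sum_(u in ~: I) u = #|~: I| * l.-1)%N.
  rewrite -(size_U (~: I)) -count_gt_sum ?sorted_val_enum //.
  rewrite -[\sum_(u in _) _]big_enum -[\sum_(u <- enum _) _](big_map val xpredT id).
  rewrite -!big_split /= big_seq (eq_bigr (fun=> l.-1)) => [|u /countE //].
  by rewrite -big_seq big_const_seq count_predT iter_addn_0 mulnC.
have card_l : (#|I| + #|~: I| = l)%N by rewrite cardsC card_ord.
move/(congr1 odd): total; rewrite !oddD !oddM.
(* With b = k and c = l: k (l - 1) = k m + k (k - 1) has the parity of k m. The case k = 0 is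
   separate because of the predecessor. *)
have parity a b c : (a + b)%N = c -> odd b && odd c.-1 = odd b && odd a.
  by case: b => [|b] <-; rewrite //= addnS /= oddD; case: (odd a); case: (odd b).
rewrite (parity _ _ _ card_l).
move: (odd (\sum_(u in _) _)) (odd 'C(_, _)) => b c.
by move: (_ && _) => e; case: b; case: c; case: e; case: (odd _).
Qed.

(** Runner 0 is empty, runner 1 holds the ungrown parts and runner 2 the grown ones, so the 3-bar
    order is an interleaving. As [grown_part I] is increasing, parts may be replaced by their
    indices. *)
Lemma bar_sign_grown l (I : {set 'I_l}) :
  bar_sign (grown I) = epsilon l #|I| * seq_sign (set_values I ++ set_values (~: I)).
Proof.
have uniq_grown : uniq (grown I).
  by apply: sorted_uniq (sorted_grown I); [apply: gtn_trans | move=> a; apply: ltnn].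
rewrite bar_sign_seq_sign // /bar_order.
have sorted_nat : sorted ltn (natural_order (grown I)).
  by rewrite ltn_sorted_uniq_leq sort_uniq uniq_grown sort_sorted //; apply: leq_total.
have sorted_runner k : sorted ltn (runner (grown I) k) by apply: (sorted_filter ltn_trans).
have mem_runner k v : (v \in runner (grown I) k) = (v %% 3 == k)%N && (v \in grown I).
  by rewrite mem_filter mem_sort.
have part_lt : {homo grown_part I : a b / (a < b)%N} by apply: grown_part_lt.
have sorted_map (U : {set 'I_l}) : sorted ltn (map (grown_part I) (set_values U)).
  by apply: (homo_sorted part_lt); apply: sorted_val_enum.
have runner0 : runner (grown I) 0 = [::].
  apply/eqP; rewrite -size_eq0 size_filter -leqn0 leqNgt -has_count; apply/hasPn => v.
  by rewrite mem_sort => /mem_grown[u _ ->]; rewrite /grown_part; case: (u \in _); lia.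
have runner1 : runner (grown I) 1 = map (grown_part I) (set_values (~: I)).
  apply: (irr_sorted_eq ltn_trans ltnn) => // v; rewrite mem_runner; apply/andP/mapP.
    case=> v1 /mem_grown[u lt_u def_v]; exists u => //; rewrite mem_set_valuesC lt_u /=.
    by apply/negP => u_I; move: v1; rewrite def_v /grown_part u_I; lia.
  case=> u; rewrite mem_set_valuesC => /andP[lt_u u_I] ->; split; last by apply/mem_grown; exists u.
  by rewrite /grown_part (negbTE u_I); lia.
have runner2 : runner (grown I) 2 = map (grown_part I) (set_values I).
  apply: (irr_sorted_eq ltn_trans ltnn) => // v; rewrite mem_runner; apply/andP/mapP.
    case=> v2 /mem_grown[u lt_u def_v]; exists u => //; apply/negPn/negP => u_I.
    by move: v2; rewrite def_v /grown_part (negbTE u_I); lia.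
  case=> u u_I ->; split; last by apply/mem_grown; exists u => //; apply: set_values_lt u_I.
  by rewrite /grown_part u_I; lia.
rewrite runner0 cat0s; set r1 := runner _ 1; set r2 := runner _ 2; set p := minn _ _.
(* After the pairing at most one of the two runners has beads left, so the remainder is already
   sorted. *)
have -> : sort leq (drop p r1 ++ drop p r2) = drop p r1 ++ drop p r2.
  apply: (sorted_sort leq_trans); apply: (sub_sorted ltnW).
  have := sorted_runner 1; have := sorted_runner 2; rewrite -/r1 -/r2 /p.
  case: leqP => _ sorted2 sorted1.
    by rewrite drop_size /=; apply: drop_sorted.
  by rewrite drop_size cats0; apply: drop_sorted.
rewrite seq_sign_interleave /r1 /r2 runner1 runner2 -map_cat seq_sign_map //.
rewrite !size_map -!cardE sign_interleave_exponent addnC cardsC card_ord //.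
Qed.

(** * The set of grown partitions *)

Lemma strict_partition_grown l (I : {set 'I_l}) : strict_partition (grown I).
Proof.
rewrite /strict_partition sorted_grown; apply/negP => /mem_grown[u _].
by rewrite /grown_part; case: (u \in _); lia.
Qed.

Lemma incr_nth_grown l (I : {set 'I_l}) (u : 'I_l) : u \notin I ->
  incr_nth (grown I) (l - u.+1) = grown (u |: I).
Proof.
move=> u_I; have lt_u := ltn_ord u; have lt_lu : (l - u.+1 < l)%N by lia.
apply: (@eq_from_nth _ 0%N) => [|i]; rewrite size_incr_nth !size_grown lt_lu // => lt_i.
rewrite nth_incr_nth !nth_grown // /grown_part.
have lt_v : (l - i.+1 < l)%N by lia.
rewrite -[(l - i.+1)%N]/(val (Ordinal lt_v)) !mem_set_values in_setU1 -val_eqE /=.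
have -> : ((l - u.+1)%N == i) = ((l - i.+1)%N == u) by apply/eqP/eqP; lia.
case: eqP => [eq_v|_] /=; last by [].
have -> : Ordinal lt_v = u by apply: val_inj.
by rewrite (negbTE u_I); lia.
Qed.

Lemma mem_add_node1_grown l (I : {set 'I_l}) mu :
  reflect (exists2 u, u \notin I & mu = grown (u |: I)) (mu \in add_node1 (grown I)).
Proof.
rewrite mem_filter; apply: (iffP andP) => [[_ /mapP[i]]|[u u_I ->]].
  rewrite mem_filter mem_iota size_grown /column_label => /andP[lab_i /andP[_ le_i]] ->.
  (* The index i = l would open a new row, whose first cell has label 0. *)
  have [lt_i|ge_i] := ltnP i l; last first.
    by move: lab_i; rewrite nth_default // size_grown.
  have lt_v : (l - i.+1 < l)%N by lia.
  (* A grown row has length 3v + 2, and the next cell, in column 3v + 3, has label 0: no row grows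
     twice. *)
  have v_I : Ordinal lt_v \notin I.
    rewrite -mem_set_values /=; move: lab_i; rewrite nth_grown // /grown_part.
    by case: (_ \in _) => //=; case: ifP => // /eqP; lia.
  exists (Ordinal lt_v) => //; rewrite -incr_nth_grown //=; congr incr_nth; lia.
rewrite strict_partition_grown; split=> //; apply/mapP; exists (l - u.+1)%N; last first.
  by rewrite incr_nth_grown.
have lt_u := ltn_ord u; rewrite mem_filter mem_iota size_grown /column_label nth_grown; last by lia.
rewrite /grown_part (_ : (l - (l - u.+1).+1 = val u)%N); last by rewrite /=; lia.
rewrite mem_set_values (negbTE u_I) ifT; last by rewrite /=; lia.
by rewrite eqxx /=; lia.
Qed.

Lemma Lambda_grown l : Lambda l = grown (set0 : {set 'I_l}).
Proof.
apply: eq_mkseq => i; rewrite /grown_part /set_values enum_set0 /= addn0 //.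
Qed.

Lemma mem_add_nodes1 l m mu :
  reflect (exists2 I : {set 'I_l}, #|I| = m & mu = grown I) (mu \in add_nodes1 m (Lambda l)).
Proof.
elim: m mu => [|m IHm] mu /=.
  rewrite inE Lambda_grown; apply: (iffP eqP) => [->|[I /cards0_eq-> ->]] //.
  by exists set0; rewrite ?cards0.
rewrite mem_undup; apply: (iffP flatten_mapP) => [[nu /IHm[I card_I ->]]|[I card_I ->]].
  case/mem_add_node1_grown => u u_I ->; exists (u |: I) => //.
  by rewrite cardsU1 u_I card_I.
have /card_gt0P[u u_I] : (0 < #|I|)%N by rewrite card_I.
exists (grown (I :\ u)).
  by apply/IHm; exists (I :\ u) => //; move: card_I; rewrite (cardsD1 u I) u_I => -[].
by apply/mem_add_node1_grown; exists u; rewrite ?setD1K // !inE eqxx.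
Qed.

Lemma grown_inj l : injective (@grown l).
Proof.
move=> I J eq_IJ; apply/setP => u; rewrite -!mem_set_values.
have lt_lu : (l - (val u).+1 < l)%N by have := ltn_ord u; lia.
have := congr1 (fun s => nth 0%N s (l - (val u).+1)) eq_IJ; rewrite !nth_grown // /grown_part.
rewrite (_ : (l - (l - (val u).+1).+1 = val u)%N); last by have := ltn_ord u; rewrite /=; lia.
by do 2!case: (_ \in _) => //; lia.
Qed.

Lemma sum_add_nodes1 (V : nmodType) l m (F : seq nat -> V) :
  \sum_(mu <- add_nodes1 m (Lambda l)) F mu = \sum_(I : {set 'I_l} | #|I| == m) F (grown I).
Proof.
rewrite -[RHS]big_filter -(big_map (@grown l) xpredT F).
apply: perm_big; apply: uniq_perm.
- by case: m => //= m; apply: undup_uniq.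
- by rewrite map_inj_uniq ?filter_uniq ?index_enum_uniq //; apply: grown_inj.
move=> mu; apply/mem_add_nodes1/mapP => [[I card_I ->]|[I]].
  by exists I => //; rewrite mem_filter card_I eqxx mem_index_enum.
by rewrite mem_filter => /andP[/eqP card_I _] ->; exists I.
Qed.

Unset Implicit Arguments.

Theorem theorem6p1 (l m : nat) (hl : (1 <= l)%N) (hm : (m <= l)%N) (n : nat) :
  \sum_(mu <- add_nodes1 m (Lambda l))
     bar_sign mu *: schur (bar_quotient1 mu) n
  = epsilon l m *: plethysm_p2 (schur (rectangle (l - m) m)) n.
Proof.
have def_l : l = (l - m + m)%N by rewrite subnK.
have fact_neq0 : ((l - m)`!)%:R != 0 :> {mpoly int[n]}.
  by rewrite -mpolyC_nat mpolyC_eq0 pnatr_eq0 -lt0n fact_gt0.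
have sorted_rect : sorted geq (rectangle (l - m) m).
  apply/(sortedP 0%N) => i; rewrite size_nseq => lt_i; rewrite !nth_nseq lt_i (ltnW lt_i) /=; exact: leqnn.
rewrite plethysm_p2_schur_jacobi_trudi // size_nseq.
have -> : jacobi_trudi (fun i => mpoly_var n i ^+ 2) (l - m) n (nth 0%N (rectangle (l - m) m)) =
    jacobi_trudi (fun i => mpoly_var n i ^+ 2) (l - m) n (fun=> m).
  by apply/matrixP => i j; rewrite !mxE nth_nseq ltn_ord.
rewrite -(sum_quotient_beads (mpoly_var n) n hl def_l fact_neq0).
(* The left side is indexed by the set I of grown parts, the expansion of the rectangle by its
   complement U. *)
rewrite sum_add_nodes1 scaler_sumr (reindex_inj (@setC_inj 'I_l)) /=.
apply: eq_big => [U|U /eqP card_U].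
  have := cardsC U; rewrite card_ord /=; move: #|U| #|~: U| => a b card_l.
  by apply/eqP/eqP; lia.
have card_CC : #|~: ~: U| = (l - m)%N.
  by rewrite setCK; have := cardsC U; rewrite card_ord card_U; lia.
rewrite (schur_bar_quotient1_grown n hl card_CC) bar_sign_grown seq_sign_complement.
rewrite card_U card_CC setCK -scalerA; congr (_ *: _).
rewrite -signr_odd -[X in _ = X * _]signr_odd; case: (odd _).
  by rewrite scaleN1r mulN1r.
by rewrite scale1r mul1r.
Qed.
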